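(* Let $h:\mathbb{D}\to\mathbb{C}$ be a holomorphic function. (1) $h$ is the Koenigs function associated to an elliptic semigroup of linear fractional self-maps of $\mathbb{D}$ which is not trivial if and only if $$h(z)=(1-\beta^{-1}\tau)\frac{z-\tau}{1-\beta^{-1}z}$$ for some $\tau\in\mathbb{D}$ and $\beta\in\mathbb{C}_\infty\setminus\mathbb{D}$. (2) $h$ is the Koenigs function associated to a hyperbolic semigroup of linear fractional self-maps of $\mathbb{D}$ if and only if there exists $\alpha\in(-\infty,0)$ such that $$h(z)=\alpha\log\left(\frac{1-\overline\tau z}{1-\beta^{-1}z}\right)$$ for some $\tau\in\partial\mathbb{D}$ and $\beta\in\mathbb{C}_\infty\setminus\mathbb{D}$, where $\log$ denotes the principal branch of the logarithm. (3) $h$ is the Koenigs function associated to a parabolic semigroup of linear fractional self-maps of $\mathbb{D}$ if and only if there exists $\alpha\ne0$ with $\mathrm{Re}\,\alpha\le0$ such that $$h(z)=\alpha\frac{z}{z-\tau}$$ for some $\tau\in\partial\mathbb{D}$.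
   Context: $\mathbb{D}$ is the open unit disc in $\mathbb{C}$, $\mathbb{C}_\infty$ is the Riemann sphere, and $\infty^{-1}$ means $0$. A (continuous) semigroup in $\mathbb{D}$ is a family $(\varphi_t)_{t\ge0}$ of holomorphic maps $\varphi_t:\mathbb{D}\to\mathbb{D}$ with $\varphi_0=\mathrm{id}$, $\varphi_{t+s}=\varphi_t\circ\varphi_s$, and $\varphi_t\to\mathrm{id}$ uniformly on compacta as $t\to0^+$; it is trivial if $\varphi_t=\mathrm{id}$ for all $t$. Its infinitesimal generator is the unique holomorphic $G:\mathbb{D}\to\mathbb{C}$ with $\frac{\partial\varphi_t(z)}{\partial t}=G(\varphi_t(z))$. A linear fractional self-map of $\mathbb{D}$ is a non-constant map $z\mapsto\frac{az+b}{cz+d}$, with $|d|>|c|$, mapping $\mathbb{D}$ into $\mathbb{D}$. A non-trivial semigroup in $\mathbb{D}$ is elliptic if there is $\tau\in\mathbb{D}$ with $\varphi_t(\tau)=\tau$ for all $t>0$; hyperbolic (resp. parabolic) if there is $\tau\in\partial\mathbb{D}$ with $\lim_{r\to1^-}\varphi_t(r\tau)=\tau$ and $\lim_{r\to1^-}\varphi_t'(r\tau)<1$ (resp. $=1$) for all $t>0$. Exactly one of these holds; the point $\tau$ is unique and is the Denjoy-Wolff point. Koenigs function of a non-trivial semigroup $(\varphi_t)$ with Denjoy-Wolff point $\tau$ and generator $G$: if $\tau\in\mathbb{D}$, it is the unique univalent holomorphic $h:\mathbb{D}\to\mathbb{C}$ with $h(\tau)=0$, $h'(\tau)=1$ and $h\circ\varphi_t=\varphi_t'(\tau)h=e^{G'(\tau)t}h$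 for all $t\ge0$; if $\tau\in\partial\mathbb{D}$, it is the unique univalent holomorphic $h:\mathbb{D}\to\mathbb{C}$ with $h(0)=0$ and $h\circ\varphi_t=h+t$ for all $t\ge0$.
   Formalization: In part (2) the formal theorem additionally requires β ≠ τ; for β = τ the printed formula gives h = 0, which is not univalent and hence not a Koenigs function, so the printed ''if'' direction fails there. *)

(* Defs.v *)
From Stdlib Require Export Reals Lra List.
From Coquelicot Require Export Coquelicot.
Export Complex.

Open Scope R_scope.
Open Scope C_scope.

Definition disc (z : C) : Prop := (Cmod z < 1)%R.
Definition circle (z : C) : Prop := Cmod z = 1%R.

Inductive sphere : Type :=
| Fin (z : C)
| Infty.

Definition outside_disc (b : sphere) : Prop :=
  match b with Fin z => ~ disc z | Infty => True end.

Definition sphere_inv (b : sphere) : C :=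
  match b with Fin z => / z | Infty => 0 end.

Definition Cexp (z : C) : C :=
  ((exp (Re z) * cos (Im z))%R, (exp (Re z) * sin (Im z))%R).

(* Principal argument, with values in (-PI, PI]. *)
Definition Carg (z : C) : R :=
  if Rle_dec 0 (Im z) then acos (Re z / Cmod z)%R
  else (- acos (Re z / Cmod z))%R.

Definition Clog (z : C) : C := (ln (Cmod z), Carg z).

Lemma Clog_principal (z : C) :
  z <> 0 -> Cexp (Clog z) = z /\ (- PI < Im (Clog z) <= PI)%R.
Proof.
intros Hz.
assert (Hm : (0 < Cmod z)%R) by now apply Cmod_gt_0.
assert (Hsq : (Cmod z * Cmod z = Re z * Re z + Im z * Im z)%R).
{ unfold Cmod, Re, Im.
  rewrite sqrt_sqrt; [ring | nra]. }
set (q := (Re z / Cmod z)%R).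
assert (Hq : (Re z = q * Cmod z)%R) by (unfold q; field; lra).
assert (Hq1 : (-1 <= q <= 1)%R).
{ apply Rabs_le_between. apply Rmult_le_reg_r with (Cmod z); [assumption |].
  rewrite <- (Rabs_right (Cmod z)) at 1 by lra.
  rewrite <- Rabs_mult, <- Hq, Rmult_1_l.
  apply Rsqr_incr_0_var; [| lra].
  rewrite <- Rsqr_abs. unfold Rsqr. nra. }
assert (Hs : (Cmod z * sqrt (1 - q²) = Rabs (Im z))%R).
{ rewrite <- (Rabs_right (Cmod z)) by lra.
  rewrite <- sqrt_Rsqr_abs, <- sqrt_mult by (unfold Rsqr; nra).
  rewrite <- sqrt_Rsqr_abs. f_equal. unfold Rsqr. nra. }
pose proof (acos_bound q) as Hb.
pose proof PI_RGT_0.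
unfold Cexp, Clog, Re at 1 2, Im at 1 2 3 4; simpl.
rewrite exp_ln by assumption.
unfold Carg; fold q.
destruct (Rle_dec 0 (Im z)) as [Hi | Hi].
- split; [| lra].
  rewrite cos_acos, sin_acos by assumption.
  rewrite Hs, Rabs_right, Rmult_comm, <- Hq by lra.
  now destruct z.
- split.
  + rewrite cos_neg, sin_neg, cos_acos, sin_acos by assumption.
    rewrite Ropp_mult_distr_r_reverse, Hs, Rabs_left, Rmult_comm, <- Hq by lra.
    rewrite Ropp_involutive. now destruct z.
  + split; [| lra].
    destruct (Req_dec (acos q) PI) as [He | He]; [| lra].
    exfalso.
    assert (q = -1)%R by (rewrite <- (cos_acos q), He by assumption; apply cos_PI).
    nra.
Qed.

(* Functions on the disc are represented by total functions on C; only their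
   restrictions to the disc matter. *)
Definition holomorphic (f : C -> C) : Prop :=
  forall z, disc z -> @ex_derive C_AbsRing C_NormedModule f z.

Definition univalent (f : C -> C) : Prop :=
  holomorphic f /\
  forall z w, disc z -> disc w -> f z = f w -> z = w.

Definition compact_set (K : C -> Prop) : Prop :=
  forall F : (C -> Prop) -> Prop,
    (forall U, F U -> @open C_UniformSpace U) ->
    (forall z, K z -> exists U, F U /\ U z) ->
    exists l : list (C -> Prop),
      (forall U, In U l -> F U) /\
      (forall z, K z -> exists U, In U l /\ U z).

(* The values [phi t] for [t < 0] are irrelevant. *)
Definition semigroup (phi : R -> C -> C) : Prop :=
  (forall t, (0 <= t)%R ->
     holomorphic (phi t) /\ forall z, disc z -> disc (phi t z)) /\
  (forall z, disc z -> phi 0%R z = z) /\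
  (forall s t z, (0 <= s)%R -> (0 <= t)%R -> disc z ->
     phi (t + s)%R z = phi t (phi s z)) /\
  (forall K : C -> Prop, compact_set K -> (forall z, K z -> disc z) ->
     forall eps : posreal,
       at_right 0 (fun t => forall z, K z -> (Cmod (phi t z - z) < eps)%R)).

Definition trivial_semigroup (phi : R -> C -> C) : Prop :=
  forall t z, (0 <= t)%R -> disc z -> phi t z = z.

(* The derivative in [t] is taken relatively to [0, +oo), so that it is
   one-sided at [t = 0]. *)
Definition infinitesimal_generator (phi : R -> C -> C) (G : C -> C) : Prop :=
  holomorphic G /\
  forall t z, (0 <= t)%R -> disc z ->
    @filterdiff R_AbsRing R_NormedModule C_R_NormedModule
      (fun s => phi s z)
      (within (fun s => (0 <= s)%R) (locally t))
      (fun s => scal s (G (phi t z))).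

Definition linear_fractional_self_map (f : C -> C) : Prop :=
  (exists a b c d : C, (Cmod d > Cmod c)%R /\
     forall z, disc z -> f z = (a * z + b) / (c * z + d)) /\
  (~ exists k : C, forall z, disc z -> f z = k) /\
  (forall z, disc z -> disc (f z)).

Definition elliptic_at (phi : R -> C -> C) (tau : C) : Prop :=
  disc tau /\ forall t, (0 < t)%R -> phi t tau = tau.

Definition boundary_fixed (f : C -> C) (tau : C) : Prop :=
  filterlim (fun r : R => f (RtoC r * tau)) (at_left 1)
    (@locally C_UniformSpace tau).

(* The angular derivative [lim_{r -> 1-} f'(r tau)] exists and equals [l]. *)
Definition boundary_derivative (f : C -> C) (tau l : C) : Prop :=
  filterlim (fun r : R => C_derive f (RtoC r * tau)) (at_left 1)
    (@locally C_UniformSpace l).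

Definition hyperbolic_at (phi : R -> C -> C) (tau : C) : Prop :=
  circle tau /\
  forall t, (0 < t)%R ->
    boundary_fixed (phi t) tau /\
    exists l : R, (l < 1)%R /\ boundary_derivative (phi t) tau (RtoC l).

Definition parabolic_at (phi : R -> C -> C) (tau : C) : Prop :=
  circle tau /\
  forall t, (0 < t)%R ->
    boundary_fixed (phi t) tau /\ boundary_derivative (phi t) tau 1.

Definition elliptic (phi : R -> C -> C) : Prop :=
  ~ trivial_semigroup phi /\ exists tau, elliptic_at phi tau.

Definition hyperbolic (phi : R -> C -> C) : Prop :=
  ~ trivial_semigroup phi /\ exists tau, hyperbolic_at phi tau.

Definition parabolic (phi : R -> C -> C) : Prop :=
  ~ trivial_semigroup phi /\ exists tau, parabolic_at phi tau.

Definition denjoy_wolff_point (phi : R -> C -> C) (tau : C) : Prop :=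
  ~ trivial_semigroup phi /\
  (elliptic_at phi tau \/ hyperbolic_at phi tau \/ parabolic_at phi tau).

Definition koenigs_function (phi : R -> C -> C) (h : C -> C) : Prop :=
  univalent h /\
  exists tau, denjoy_wolff_point phi tau /\
    ((disc tau /\ h tau = 0 /\ C_derive h tau = 1 /\
      exists G, infinitesimal_generator phi G /\
        forall t z, (0 <= t)%R -> disc z ->
          h (phi t z) = C_derive (phi t) tau * h z /\
          C_derive (phi t) tau * h z = Cexp (C_derive G tau * RtoC t) * h z)
     \/
     (circle tau /\ h 0 = 0 /\
      forall t z, (0 <= t)%R -> disc z -> h (phi t z) = h z + RtoC t)).

Definition linear_fractional_semigroup (phi : R -> C -> C) : Prop :=
  semigroup phi /\
  forall t, (0 <= t)%R -> linear_fractional_self_map (phi t).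

(* Main.v *)
From Stdlib Require Import IndefiniteDescription Classical.
Require Import Defs.

(** A semigroup of linear fractional self-maps has a generator that is a polynomial of degree at
most two, so its Koenigs function solves a differential equation that can be integrated explicitly.

From the semigroup to the formula. Write [phi t z = (a z + b) / (c z + 1)], with [a], [b], [c]
depending on [t]. Then [(phi t z - z) (c z + 1) / t] is a quadratic polynomial in [z] whose
coefficients are determined by its values at three points. Hence, as soon as the orbits of three
points are differentiable at [t = 0], the coefficients converge and all orbits are differentiable
with speed a quadratic polynomial [g] ([infinitesimal_coefficients_exist], [orbit_slope_limit]). In
the elliptic case differentiability is part of the definition of the Koenigs function. In the other
cases it follows from [h (phi t z) = h z + t] at every point where the derivative of [h] does not
vanish; since [h] is injective, it is not constant on any segment, and such points exist on three
different horizontal lines ([regular_point_on_line]). In this way the fact that univalent functions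
have no critical point is not an input, but an output.

Differentiating the functional equation at [t = 0] gives [h' g = lambda h] in the elliptic case and
[h' g = 1] in the other ones. The fixed point [tau] is a root of [g], so [g z = A (z - tau) (1 - k
z)], where [|k| <= 1] because [g] has no other root in the disc; [1 / k] is the point [beta]. The
derivative of [phi t] at [tau] governs [g' tau = A (1 - k tau)] ([infinitesimal_multiplier]): this
number is [lambda] in the elliptic case, a nonpositive real number in the hyperbolic case, and [0]
in the parabolic case. Comparing derivatives along segments yields the three formulas
([elliptic_koenigs], [hyperbolic_koenigs], [parabolic_koenigs]).

A Koenigs function may a priori refer to another point than the one witnessing the type of the
semigroup. That no linear fractional self-map has an interior fixed point together with a boundary
fixed point of multiplier less than one ([interior_and_boundary_fixed_points]) settles this.

From the formula to the semigroup. In the coordinate [h] the semigroup must be a dilation or a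
translation, and both kinds of maps have the single form [moebius tau b e], with [b = 1 / beta] and
a parameter [e] depending on [t]. Everything is proved for this family at once from the properties
gathered in [flow_parameter]; only the invariance of the disc is specific to each kind, and it comes
from explicit positive expressions for [|denominator|^2 - |numerator|^2] ([dilation_flow],
[parabolic_flow]). *)

Notation C_is_derive := (@is_derive C_AbsRing C_NormedModule).

(** * Complex limits *)

Definition clim {T : Type} (F : (T -> Prop) -> Prop) (u : T -> C) (l : C) : Prop :=
  filterlim u F (@locally C_UniformSpace l).

Lemma locally_Cmod (l : C) (P : C -> Prop) :
  @locally C_UniformSpace l P <->
  exists d : posreal, forall w, (Cmod (w - l) < d)%R -> P w.
Proof.
  rewrite locally_C. split; intros [d Hd]; exists d; exact Hd.
Qed.

Lemma clim_eps {T : Type} (F : (T -> Prop) -> Prop) {FF : Filter F} (u : T -> C) (l : C) :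
  clim F u l <-> forall eps : posreal, F (fun x => (Cmod (u x - l) < eps)%R).
Proof.
  split.
  - intros H eps. apply (H (fun w => (Cmod (w - l) < eps)%R)).
    apply locally_Cmod. now exists eps.
  - intros H P HP. apply locally_Cmod in HP. destruct HP as [d Hd].
    unfold filtermap. generalize (H d). apply filter_imp. intros x. apply Hd.
Qed.

Section Limits.
Context {T : Type} {F : (T -> Prop) -> Prop}.

Lemma clim_const {FF : Filter F} (l : C) : clim F (fun _ => l) l.
Proof. apply filterlim_const. Qed.

Lemma clim_ext {FF : Filter F} (u v : T -> C) (l : C) :
  F (fun x => u x = v x) -> clim F u l -> clim F v l.
Proof. apply filterlim_ext_loc. Qed.

Lemma clim_value (u : T -> C) (l m : C) : l = m -> clim F u l -> clim F u m.
Proof. now intros ->. Qed.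

Lemma clim_plus {FF : Filter F} (u v : T -> C) (l m : C) :
  clim F u l -> clim F v m -> clim F (fun x => u x + v x) (l + m).
Proof.
  intros Hu Hv. eapply filterlim_comp_2; [exact Hu | exact Hv |].
  exact (@filterlim_plus R_AbsRing C_R_NormedModule l m).
Qed.

Lemma clim_opp {FF : Filter F} (u : T -> C) (l : C) :
  clim F u l -> clim F (fun x => - u x) (- l).
Proof.
  intros Hu. eapply filterlim_comp; [exact Hu |].
  exact (@filterlim_opp R_AbsRing C_R_NormedModule l).
Qed.

Lemma clim_minus {FF : Filter F} (u v : T -> C) (l m : C) :
  clim F u l -> clim F v m -> clim F (fun x => u x - v x) (l - m).
Proof. intros Hu Hv. apply clim_plus; [assumption | now apply clim_opp]. Qed.

Lemma clim_mult {FF : Filter F} (u v : T -> C) (l m : C) :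
  clim F u l -> clim F v m -> clim F (fun x => u x * v x) (l * m).
Proof.
  intros Hu Hv P HP. apply locally_C in HP.
  assert (Hu' : filterlim u F (@locally (AbsRing_UniformSpace C_AbsRing) l))
    by (intros Q HQ; apply Hu; now apply locally_C).
  assert (Hv' : filterlim v F (@locally (AbsRing_UniformSpace C_AbsRing) m))
    by (intros Q HQ; apply Hv; now apply locally_C).
  assert (Huv : filterlim (fun x => u x * v x) F
                  (@locally (AbsRing_UniformSpace C_AbsRing) (l * m))).
  { eapply filterlim_comp_2; [exact Hu' | exact Hv' |].
    exact (@filterlim_mult C_AbsRing l m). }
  exact (Huv P HP).
Qed.

Lemma clim_neq {FF : Filter F} (u : T -> C) (l k : C) :
  clim F u l -> l <> k -> F (fun x => u x <> k).
Proof.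
  intros Hu Hl.
  assert (Hp : (0 < Cmod (l - k))%R) by (apply Cmod_gt_0; now apply Cminus_eq_contra).
  generalize (proj1 (clim_eps F u l) Hu (mkposreal _ Hp)). apply filter_imp.
  simpl. intros x Hx E. rewrite E in Hx.
  replace (k - l) with (- (l - k)) in Hx by ring. rewrite Cmod_opp in Hx. lra.
Qed.

Lemma clim_inv {FF : Filter F} (u : T -> C) (l : C) :
  clim F u l -> l <> 0 -> clim F (fun x => / u x) (/ l).
Proof.
  intros Hu Hl. assert (Hm : (0 < Cmod l)%R) by now apply Cmod_gt_0.
  apply clim_eps; [assumption |]. intros eps.
  assert (He : (0 < eps * (Cmod l * Cmod l / 2))%R)
    by (apply Rmult_lt_0_compat; [apply cond_pos | nra]).
  assert (He2 : (0 < Cmod l / 2)%R) by lra.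
  generalize (filter_and _ _ (proj1 (clim_eps F u l) Hu (mkposreal _ He))
               (proj1 (clim_eps F u l) Hu (mkposreal _ He2))).
  apply filter_imp. simpl. intros x [H1 H2].
  assert (H3 : (Cmod l / 2 < Cmod (u x))%R).
  { pose proof (Cmod_triangle (u x) (- (u x - l))) as H.
    replace (u x + - (u x - l)) with l in H by ring. rewrite Cmod_opp in H. lra. }
  assert (Hx : u x <> 0) by (apply Cmod_gt_0; lra).
  replace (/ u x - / l) with (- (u x - l) / (u x * l)) by now field.
  rewrite Cmod_div, Cmod_opp, Cmod_mult by now apply Cmult_neq_0.
  apply Rmult_lt_reg_r with (Cmod (u x) * Cmod l)%R; [nra |].
  unfold Rdiv. rewrite Rmult_assoc, Rinv_l, Rmult_1_r by nra.
  eapply Rlt_trans; [exact H1 |].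
  apply Rmult_lt_compat_l; [apply cond_pos | nra].
Qed.

Lemma clim_div {FF : Filter F} (u v : T -> C) (l m : C) :
  clim F u l -> clim F v m -> m <> 0 -> clim F (fun x => u x / v x) (l / m).
Proof. intros. apply clim_mult; [assumption | now apply clim_inv]. Qed.

Lemma clim_unique {FF : ProperFilter F} (u : T -> C) (l m : C) :
  clim F u l -> clim F u m -> l = m.
Proof. apply (@filterlim_locally_unique T R_AbsRing C_R_NormedModule F _). Qed.

End Limits.

Lemma clim_id (z : C) : clim (@locally C_UniformSpace z) (fun w => w) z.
Proof. apply filterlim_id. Qed.

(** * Derivatives as limits of slopes *)

(** Carathéodory's form of differentiability: with the difference quotient extended by continuity,
increments of [f] become exact products, and chain rules reduce to products of limits. *)
Lemma caratheodory (f : C -> C) (z d : C) :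
  C_is_derive f z d ->
  exists S, clim (@locally C_UniformSpace z) S d /\
    forall w, f w = f z + S w * (w - z).
Proof.
  intros [_ H]. specialize (H z (fun P HP => HP)).
  (* The difference quotient takes the value of the derivative at [z] itself. *)
  exists (fun w => if Ceq_dec w z then d else (f w - f z) / (w - z)).
  split.
  - apply clim_eps; [typeclasses eauto |]. intros eps.
    apply locally_C. generalize (H (pos_div_2 eps)). simpl. apply filter_imp. intros w Hw.
    destruct (Ceq_dec w z) as [E | E].
    + replace (d - d) with (0:C) by ring. rewrite Cmod_0. apply cond_pos.
    + assert (Hn : w - z <> 0) by now apply Cminus_eq_contra.
      assert (Hp : (0 < Cmod (w - z))%R) by now apply Cmod_gt_0.
      change (Cmod (f w - f z - (w - z) * d) <= eps / 2 * Cmod (w - z))%R in Hw.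
      replace ((f w - f z) / (w - z) - d) with ((f w - f z - (w - z) * d) / (w - z))
        by now field.
      rewrite Cmod_div by assumption.
      apply Rmult_lt_reg_r with (Cmod (w - z)); [assumption |].
      unfold Rdiv. rewrite Rmult_assoc, Rinv_l, Rmult_1_r by lra.
      pose proof (cond_pos eps). nra.
  - intros w. destruct (Ceq_dec w z) as [-> | E]; [ring |].
    field. now apply Cminus_eq_contra.
Qed.

Lemma derive_of_slope (f S : C -> C) (z d : C) :
  @locally C_UniformSpace z (fun w => f w = f z + S w * (w - z)) ->
  clim (@locally C_UniformSpace z) S d ->
  C_is_derive f z d.
Proof.
  intros Hf HS. split; [apply is_linear_scal_l |].
  intros x Hx.
  apply (@is_filter_lim_locally_unique C_AbsRing (AbsRing_NormedModule C_AbsRing)) in Hx. subst x.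
  intros eps. apply -> locally_C.
  generalize (filter_and _ _ Hf (proj1 (clim_eps _ S d) HS eps)). apply filter_imp.
  intros w [E Hw].
  change (Cmod (f w - f z - (w - z) * d) <= eps * Cmod (w - z))%R.
  rewrite E. replace (f z + S w * (w - z) - f z - (w - z) * d) with ((S w - d) * (w - z)) by ring.
  rewrite Cmod_mult. apply Rmult_le_compat_r; [apply Cmod_ge_0 | lra].
Qed.

(** The filter is left general so that the statement covers both ordinary derivatives along a path
and derivatives relative to the half-line of nonnegative times. *)
Lemma path_derive_of_slope (F : (R -> Prop) -> Prop) {FF : ProperFilter F}
  (u S : R -> C) (t : R) (d : C) :
  filter_le F (locally t) ->
  F (fun s => u s = u t + S s * RtoC (s - t)) ->
  clim F S d ->
  @filterdiff R_AbsRing R_NormedModule C_R_NormedModule u F (fun s => scal s d).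
Proof.
  intros HF Hu HS. split; [apply (@is_linear_scal_l R_AbsRing C_R_NormedModule) |].
  intros x Hx.
  assert (x = t) as ->.
  { apply (@is_filter_lim_unique R_AbsRing R_NormedModule F _ x t); [exact Hx | exact HF]. }
  intros eps.
  generalize (filter_and _ _ Hu (proj1 (clim_eps _ S d) HS eps)). apply filter_imp.
  intros s [E Hw].
  change (@norm R_AbsRing C_R_NormedModule
    (u s - u t - (scal (s - t)%R d : C_R_NormedModule))%C <= eps * Rabs (s - t))%R.
  rewrite E, scal_R_Cmult.
  replace (u t + S s * RtoC (s - t) - u t - RtoC (s - t) * d) with ((S s - d) * RtoC (s - t)) by ring.
  rewrite <- Cmod_norm, Cmod_mult, Cmod_R.
  apply Rmult_le_compat_r; [apply Rabs_pos | lra].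
Qed.

Lemma clim_RtoC {T : Type} {F : (T -> Prop) -> Prop} {FF : Filter F} (f : T -> R) (x : R) :
  filterlim f F (locally x) -> clim F (fun t => RtoC (f t)) (RtoC x).
Proof.
  intros H. apply clim_eps; [assumption |]. intros eps.
  apply (filter_imp (fun t => (Rabs (f t - x) < eps)%R)).
  - intros t Ht. now rewrite <- RtoC_minus, Cmod_R.
  - apply (H (fun y => (Rabs (y - x) < eps)%R)). now exists eps.
Qed.

Lemma clim_comp {T : Type} {F : (T -> Prop) -> Prop} (S : C -> C) (u : T -> C) (z d : C) :
  clim (@locally C_UniformSpace z) S d -> clim F u z -> clim F (fun t => S (u t)) d.
Proof. intros HS Hu. exact (filterlim_comp _ _ _ _ _ _ _ _ Hu HS). Qed.

(** * Geometry of the disc and integration along segments *)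

Lemma disc_open (z : C) : disc z -> @locally C_UniformSpace z disc.
Proof.
  intros Hz. apply locally_Cmod. unfold disc in *.
  assert (Hd : (0 < 1 - Cmod z)%R) by lra.
  exists (mkposreal _ Hd). simpl. intros w Hw.
  replace w with (w - z + z) by ring.
  pose proof (Cmod_triangle (w - z) z). lra.
Qed.

Lemma holomorphic_derive (h : C -> C) (z : C) :
  holomorphic h -> disc z -> exists d : C, C_is_derive h z d.
Proof. intros H Hz. exact (H z Hz). Qed.

(** Functions matter only on the disc, which is open, so derivatives there may be computed from any
formula valid on the disc. *)
Lemma derive_ext_disc (f g : C -> C) (z d : C) :
  disc z -> (forall w, disc w -> f w = g w) -> C_is_derive f z d -> C_is_derive g z d.
Proof.
  intros Hz E. apply is_derive_ext_loc. apply locally_C.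
  generalize (disc_open z Hz). now apply filter_imp.
Qed.

Lemma disc_convex (p q : C) (s : R) :
  disc p -> disc q -> (0 <= s <= 1)%R -> disc (p + RtoC s * (q - p)).
Proof.
  unfold disc. intros Hp Hq Hs.
  replace (p + RtoC s * (q - p)) with (RtoC (1 - s) * p + RtoC s * q)
    by (rewrite RtoC_minus; ring).
  eapply Rle_lt_trans; [apply Cmod_triangle |].
  rewrite 2!Cmod_mult, 2!Cmod_R, 2!Rabs_right by lra.
  destruct (Rle_lt_dec s (/ 2)); nra.
Qed.

Lemma one_minus_neq_0 (x : C) : (Cmod x < 1)%R -> 1 - x <> 0.
Proof.
  intros H E. assert (x = 1) as -> by (rewrite <- (Cplus_0_r x), <- E; ring).
  rewrite Cmod_1 in H. lra.
Qed.

Lemma Cmod_mult_lt_1 (b z : C) : (Cmod b <= 1)%R -> disc z -> (Cmod (b * z) < 1)%R.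
Proof.
  unfold disc. intros Hb Hz. rewrite Cmod_mult.
  pose proof (Cmod_ge_0 b). pose proof (Cmod_ge_0 z). nra.
Qed.

Lemma circle_conj (tau : C) : circle tau -> tau * Cconj tau = 1.
Proof.
  intros H. rewrite <- Cmod2_conj, H. f_equal. ring.
Qed.

Lemma circle_neq_0 (tau : C) : circle tau -> tau <> 0.
Proof. intros H. apply Cmod_gt_0. rewrite H. lra. Qed.

Lemma disc_circle_neq (z tau : C) : disc z -> circle tau -> z <> tau.
Proof. unfold disc, circle. intros Hz Ht ->. lra. Qed.

Lemma Cmod_sq (z : C) : (Cmod z * Cmod z = fst z * fst z + snd z * snd z)%R.
Proof. pose proof (Cmod2_alt z) as H. unfold Re, Im in H. lra. Qed.

Lemma Cmod_lt_of_sq (z w : C) :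
  (fst z * fst z + snd z * snd z < fst w * fst w + snd w * snd w)%R -> (Cmod z < Cmod w)%R.
Proof.
  rewrite <- 2!Cmod_sq. pose proof (Cmod_ge_0 z). pose proof (Cmod_ge_0 w). nra.
Qed.

Lemma derive_linear_fractional (a b c d z : C) :
  c * z + d <> 0 ->
  C_is_derive (fun w => (a * w + b) / (c * w + d)) z
    ((a * d - b * c) / ((c * z + d) * (c * z + d))).
Proof.
  intros Hz.
  assert (HD : clim (@locally C_UniformSpace z) (fun w => c * w + d) (c * z + d)).
  { apply clim_plus; [apply clim_mult; [apply clim_const | apply clim_id] | apply clim_const]. }
  apply (derive_of_slope _ (fun w => (a * d - b * c) / ((c * w + d) * (c * z + d)))).
  - generalize (clim_neq _ _ 0 HD Hz). apply filter_imp. intros w Hw. now field.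
  - apply clim_div; [apply clim_const | | now apply Cmult_neq_0].
    apply clim_mult; [exact HD | apply clim_const].
Qed.

Lemma derive_along_path (f : C -> C) (p v d : C) (s : R) :
  C_is_derive f (p + RtoC s * v) d ->
  @is_derive R_AbsRing C_R_NormedModule (fun r : R => f (p + RtoC r * v)) s (d * v).
Proof.
  intros H. apply caratheodory in H. destruct H as (S & HS & HfS).
  apply (path_derive_of_slope (locally s) (fun r : R => f (p + RtoC r * v))
           (fun r => S (p + RtoC r * v) * v) s).
  - apply filter_le_refl.
  - apply filter_forall. intros r. rewrite (HfS (p + RtoC r * v)), RtoC_minus. ring.
  - apply clim_mult; [| apply clim_const].
    eapply clim_comp; [exact HS |].
    apply clim_plus; [apply clim_const |].
    apply clim_mult; [| apply clim_const].
    apply clim_RtoC, filterlim_id.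
Qed.

Lemma path_derive_scal (u : R -> C) (k s : R) (d : C) :
  @is_derive R_AbsRing C_R_NormedModule u s d ->
  @is_derive R_AbsRing C_R_NormedModule (fun r => RtoC k * u r) s (RtoC k * d).
Proof.
  intros H.
  apply (is_derive_ext (fun r => scal k (u r : C_R_NormedModule))).
  { intros r. apply scal_R_Cmult. }
  apply (filterdiff_ext_lin _ (fun y : R => scal k (scal y (d : C_R_NormedModule)))).
  - exact (@filterdiff_scal_r_fct R_AbsRing R_NormedModule C_R_NormedModule _ _ k
             u _ Rmult_comm H).
  - intros y. rewrite !scal_R_Cmult.
    change (RtoC k * (RtoC y * d) = RtoC y * (RtoC k * d)). ring.
Qed.

Lemma constant_on_segment (f : C -> C) (p q : C) :
  (forall s : R, (0 <= s <= 1)%R -> C_is_derive f (p + RtoC s * (q - p)) (RtoC 0)) -> f p = f q.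
Proof.
  intros H.
  replace (f p) with (f (p + RtoC 0 * (q - p))) by (f_equal; ring).
  replace (f q) with (f (p + RtoC 1 * (q - p))) by (f_equal; ring).
  apply (@eq_is_derive C_R_NormedModule (fun r => f (p + RtoC r * (q - p)))); [| lra].
  intros t Ht. pose proof (derive_along_path f p (q - p) 0 t (H t Ht)) as D.
  rewrite Cmult_0_l in D. exact D.
Qed.

(** Primitives on the disc are unique since it is convex: the difference is constant on each radius. *)
Lemma equal_of_derive (f g f' : C -> C) :
  (forall z, disc z -> C_is_derive f z (f' z)) ->
  (forall z, disc z -> C_is_derive g z (f' z)) ->
  f 0 = g 0 -> forall z, disc z -> f z = g z.
Proof.
  intros Hf Hg E z Hz.
  assert (D0 : disc 0) by (unfold disc; rewrite Cmod_0; lra).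
  cut (f 0 - g 0 = f z - g z).
  { rewrite E. intros H. replace (f z) with (f z - g z + g z) by ring. rewrite <- H. ring. }
  apply (constant_on_segment (fun w => f w - g w)). intros s Hs.
  pose proof (disc_convex 0 z s D0 Hz Hs) as Hd.
  pose proof (@is_derive_minus C_AbsRing C_NormedModule f g _ _ _ (Hf _ Hd) (Hg _ Hd)) as D.
  rewrite (@minus_eq_zero C_NormedModule) in D. exact D.
Qed.

(** * Radial limits of linear fractional maps *)

Lemma radial_limit (tau : C) : clim (at_left 1) (fun r : R => RtoC r * tau) tau.
Proof.
  pattern tau at 2. rewrite <- (Cmult_1_l tau).
  apply clim_mult; [| apply clim_const].
  apply clim_RtoC. intros P HP. apply filter_le_within, HP.
Qed.

Lemma radial_disc (tau : C) : circle tau -> at_left 1 (fun r : R => disc (RtoC r * tau)).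
Proof.
  intros Ht. exists (mkposreal _ Rlt_0_1). simpl. intros r Hr Hr1.
  unfold disc. rewrite Cmod_mult, Ht, Cmod_R, Rmult_1_r.
  apply Rabs_def1; apply (Rabs_lt_between' r 1 1) in Hr; lra.
Qed.

Section Boundary.
Variables (f : C -> C) (a b c d tau : C).
Hypothesis Htau : circle tau.
Hypothesis Hden : c * tau + d <> 0.
Hypothesis Hf : forall z, disc z -> f z = (a * z + b) / (c * z + d).

Let den_limit : clim (at_left 1) (fun r : R => c * (RtoC r * tau) + d) (c * tau + d).
Proof.
  apply clim_plus; [apply clim_mult; [apply clim_const | apply radial_limit] | apply clim_const].
Qed.

(** A linear fractional map whose pole is off [tau] is continuous there, so that the radial limits
in the definitions of the boundary fixed points are the values of the formula. *)
Lemma boundary_value_linear_fractional :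
  clim (at_left 1) (fun r : R => f (RtoC r * tau)) ((a * tau + b) / (c * tau + d)).
Proof.
  apply (clim_ext (fun r : R => (a * (RtoC r * tau) + b) / (c * (RtoC r * tau) + d))).
  - generalize (radial_disc tau Htau). apply filter_imp. intros r Hr. symmetry. now apply Hf.
  - apply clim_div; [| exact den_limit | exact Hden].
    apply clim_plus; [apply clim_mult; [apply clim_const | apply radial_limit] | apply clim_const].
Qed.

Lemma boundary_derivative_linear_fractional :
  boundary_derivative f tau ((a * d - b * c) / ((c * tau + d) * (c * tau + d))).
Proof.
  apply (clim_ext (fun r : R => (a * d - b * c) /
           ((c * (RtoC r * tau) + d) * (c * (RtoC r * tau) + d)))).
  - generalize (filter_and _ _ (radial_disc tau Htau) (clim_neq _ _ 0 den_limit Hden)).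
    apply filter_imp. intros r [Hr Hn]. symmetry. apply is_C_derive_unique.
    apply (derive_ext_disc (fun w => (a * w + b) / (c * w + d))); [exact Hr | |].
    + intros w Hw. symmetry. now apply Hf.
    + now apply derive_linear_fractional.
  - apply clim_div; [apply clim_const | | now apply Cmult_neq_0].
    apply clim_mult; exact den_limit.
Qed.
End Boundary.

(** * Moebius maps with a prescribed pair of fixed points *)

(** The map fixing [tau] and [1 / b] which becomes the multiplication by [1 - e (1 - b tau)] in the
coordinate [(z - tau) / (1 - b z)]. When [b tau = 1] both fixed points coincide and it becomes the
translation by [- e / tau] in the coordinate [1 / (z - tau)]. Parametrizing by [e] rather than by
the multiplier is what makes the two cases a single family. *)
Definition moebius (tau b e z : C) : C := (z - e * (z - tau)) / (1 - e * b * (z - tau)).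

Lemma moebius_linear_fractional (tau b e z : C) :
  moebius tau b e z = ((1 - e) * z + e * tau) / ((- (e * b)) * z + (1 + e * b * tau)).
Proof. unfold moebius. f_equal; ring. Qed.

Lemma moebius_0 (tau b z : C) : moebius tau b 0 z = z.
Proof. unfold moebius. field. Qed.

Lemma moebius_fixed_point (tau b e : C) : moebius tau b e tau = tau.
Proof. unfold moebius. replace (tau - tau) with (0 : C) by ring. field. Qed.

Lemma moebius_minus_tau (tau b e z : C) :
  1 - e * b * (z - tau) <> 0 ->
  moebius tau b e z - tau = (1 - e * (1 - b * tau)) * (z - tau) / (1 - e * b * (z - tau)).
Proof. intros H. unfold moebius. now field. Qed.

Lemma one_minus_moebius (tau b e z : C) :
  1 - e * b * (z - tau) <> 0 ->
  1 - b * moebius tau b e z = (1 - b * z) / (1 - e * b * (z - tau)).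
Proof. intros H. unfold moebius. now field. Qed.

Lemma moebius_minus_moebius (tau b e e' z : C) :
  1 - e * b * (z - tau) <> 0 -> 1 - e' * b * (z - tau) <> 0 ->
  moebius tau b e' z - moebius tau b e z =
    - ((e' - e) * (z - tau) * (1 - b * z)) /
      ((1 - e * b * (z - tau)) * (1 - e' * b * (z - tau))).
Proof. intros H H'. unfold moebius. field. now split. Qed.

(** The composition law of the parameters expresses that [1 - e (1 - b tau)] is multiplicative, and
degenerates to addition when [b tau = 1]. *)
Lemma moebius_comp (tau b e e' z : C) :
  1 - e' * b * (z - tau) <> 0 ->
  1 - e * b * (moebius tau b e' z - tau) <> 0 ->
  1 - (e + e' - (1 - b * tau) * e * e') * b * (z - tau) <> 0 ->
  moebius tau b e (moebius tau b e' z) = moebius tau b (e + e' - (1 - b * tau) * e * e') z.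
Proof.
  intros H H1 H2. unfold moebius at 1.
  assert (E : 1 - e * b * (moebius tau b e' z - tau) =
    (1 - (e + e' - (1 - b * tau) * e * e') * b * (z - tau)) / (1 - e' * b * (z - tau)))
    by (unfold moebius; now field).
  rewrite E. unfold moebius. field. now split.
Qed.

Lemma moebius_injective (tau b e z w : C) :
  1 - e * (1 - b * tau) <> 0 ->
  1 - e * b * (z - tau) <> 0 -> 1 - e * b * (w - tau) <> 0 ->
  moebius tau b e z = moebius tau b e w -> z = w.
Proof.
  intros Hd Hz Hw E.
  assert (H : (1 - e * (1 - b * tau)) * (z - w) = 0).
  { replace ((1 - e * (1 - b * tau)) * (z - w)) with
      ((moebius tau b e z - moebius tau b e w) * ((1 - e * b * (z - tau)) * (1 - e * b * (w - tau))))
      by (unfold moebius; field; now split).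
    rewrite E. ring. }
  destruct (Ceq_dec (z - w) 0) as [E0 | E0]; [now apply Ceq_minus |].
  exfalso. now apply (Cmult_neq_0 _ _ Hd E0).
Qed.

(** * Semigroups of Moebius maps with common fixed points *)

(** What is needed of a path of parameters for the maps [moebius tau b (e t)] to form a semigroup of
linear fractional self-maps of the disc. The last two conditions put the pole outside the closed
disc and make the numerator smaller than the denominator on the disc. *)
Record flow_parameter (tau b : C) (e : R -> C) : Prop := {
  flow_tau : (Cmod tau <= 1)%R;
  flow_b : (Cmod b <= 1)%R;
  flow_0 : e 0%R = 0;
  flow_add : forall s t, (0 <= s)%R -> (0 <= t)%R ->
    e (t + s)%R = e t + e s - (1 - b * tau) * e t * e s;
  flow_limit : clim (at_right 0) e 0;
  flow_mult : forall t, 1 - e t * (1 - b * tau) <> 0;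
  flow_pole : forall t, (0 <= t)%R -> (Cmod (e t * b) < Cmod (1 + e t * b * tau))%R;
  flow_self_map : forall t z, (0 <= t)%R -> disc z ->
    (Cmod (z - e t * (z - tau)) < Cmod (1 - e t * b * (z - tau)))%R
}.

Section Flow.
Variables (tau b : C) (e : R -> C).
Hypothesis He : flow_parameter tau b e.

Lemma flow_den (t : R) (z : C) :
  (0 <= t)%R -> disc z -> 1 - e t * b * (z - tau) <> 0.
Proof.
  intros Ht Hz. apply Cmod_gt_0.
  eapply Rle_lt_trans; [apply Cmod_ge_0 | exact (flow_self_map _ _ _ He t z Ht Hz)].
Qed.

Lemma flow_disc (t : R) (z : C) : (0 <= t)%R -> disc z -> disc (moebius tau b (e t) z).
Proof.
  intros Ht Hz. unfold disc, moebius. rewrite Cmod_div by now apply flow_den.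
  pose proof (flow_self_map _ _ _ He t z Ht Hz).
  pose proof (Cmod_ge_0 (z - e t * (z - tau))).
  apply Rmult_lt_reg_r with (Cmod (1 - e t * b * (z - tau))); [lra |].
  unfold Rdiv. rewrite Rmult_assoc, Rinv_l; lra.
Qed.

Lemma flow_semigroup_law (s t : R) (z : C) :
  (0 <= s)%R -> (0 <= t)%R -> disc z ->
  moebius tau b (e (t + s)) z = moebius tau b (e t) (moebius tau b (e s) z).
Proof.
  intros Hs Ht Hz. rewrite (flow_add _ _ _ He) by assumption.
  symmetry. apply moebius_comp.
  - now apply flow_den.
  - apply flow_den; [assumption | now apply flow_disc].
  - rewrite <- (flow_add _ _ _ He) by assumption. apply flow_den; [lra | assumption].
Qed.

Lemma moebius_derive (t : R) (z : C) :
  (0 <= t)%R -> disc z ->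
  C_is_derive (moebius tau b (e t)) z
   ((1 - e t * (1 - b * tau)) / ((1 - e t * b * (z - tau)) * (1 - e t * b * (z - tau)))).
Proof.
  intros Ht Hz.
  apply (derive_ext_disc (fun w => ((1 - e t) * w + e t * tau) /
          ((- (e t * b)) * w + (1 + e t * b * tau)))); [assumption | |].
  - intros w _. symmetry. apply moebius_linear_fractional.
  - pose proof (flow_den t z Ht Hz) as Hn.
    replace (1 - e t * b * (z - tau)) with ((- (e t * b)) * z + (1 + e t * b * tau))
      in Hn |- * by ring.
    replace (1 - e t * (1 - b * tau)) with
      ((1 - e t) * (1 + e t * b * tau) - e t * tau * (- (e t * b))) by ring.
    now apply derive_linear_fractional.
Qed.

(** The displacement is [- e (z - tau) (1 - b z)] over the denominator; the first factor tends to
[0], the others are at most [2] and the denominator is at least [1 / 2] once [|e t| <= 1 / 4], so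
the convergence is uniform on the whole disc. *)
Lemma flow_near_identity (eps : posreal) :
  at_right 0 (fun t => forall z, disc z -> (Cmod (moebius tau b (e t) z - z) < eps)%R).
Proof.
  assert (Hp : (0 < Rmin (/ 4) (eps / 8))%R)
    by (apply Rmin_pos; [lra | pose proof (cond_pos eps); lra]).
  assert (Hpos : at_right 0 (fun t => (0 < t)%R))
    by (exists (mkposreal _ Rlt_0_1); auto).
  generalize (filter_and _ _ Hpos
    (proj1 (clim_eps _ e 0) (flow_limit _ _ _ He) (mkposreal _ Hp))).
  apply filter_imp. simpl. intros t [Ht He'] z Hz.
  replace (e t - 0) with (e t) in He' by ring.
  pose proof (Rmin_l (/ 4) (eps / 8)). pose proof (Rmin_r (/ 4) (eps / 8)).
  pose proof (flow_tau _ _ _ He) as Hta. pose proof (flow_b _ _ _ He) as Hb.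
  pose proof (flow_den t z (Rlt_le _ _ Ht) Hz) as Hn.
  replace (moebius tau b (e t) z - z) with
    ((- e t) * ((z - tau) * (1 - b * z)) / (1 - e t * b * (z - tau))) by (unfold moebius; now field).
  assert (H1 : (Cmod (z - tau) <= 2)%R).
  { unfold Cminus. eapply Rle_trans; [apply Cmod_triangle |]. rewrite Cmod_opp. unfold disc in Hz. lra. }
  assert (H2 : (Cmod (1 - b * z) <= 2)%R).
  { unfold Cminus. eapply Rle_trans; [apply Cmod_triangle |].
    rewrite Cmod_opp, Cmod_1. pose proof (Cmod_mult_lt_1 b z Hb Hz). lra. }
  assert (H3 : (Cmod (e t * b * (z - tau)) <= / 2)%R).
  { rewrite 2!Cmod_mult. pose proof (Cmod_ge_0 (e t)). pose proof (Cmod_ge_0 b).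
    pose proof (Cmod_ge_0 (z - tau)).
    apply Rle_trans with (Cmod (e t) * 1 * 2)%R; [| lra].
    apply Rmult_le_compat; nra. }
  assert (H4 : (/ 2 <= Cmod (1 - e t * b * (z - tau)))%R).
  { pose proof (Cmod_triangle (1 - e t * b * (z - tau)) (e t * b * (z - tau))) as H'.
    replace (1 - e t * b * (z - tau) + e t * b * (z - tau)) with (1 : C) in H' by ring.
    rewrite Cmod_1 in H'. lra. }
  rewrite Cmod_div, 2!Cmod_mult, Cmod_opp by assumption.
  apply Rmult_lt_reg_r with (Cmod (1 - e t * b * (z - tau))); [lra |].
  unfold Rdiv. rewrite Rmult_assoc, Rinv_l, Rmult_1_r by lra.
  pose proof (Cmod_ge_0 (e t)). pose proof (Cmod_ge_0 (z - tau)). pose proof (Cmod_ge_0 (1 - b * z)).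
  assert (Hprod : (Cmod (z - tau) * Cmod (1 - b * z) <= 4)%R) by nra.
  apply Rle_lt_trans with (Cmod (e t) * 4)%R; [nra |].
  pose proof (cond_pos eps). nra.
Qed.

Lemma flow_linear_fractional_semigroup :
  linear_fractional_semigroup (fun t => moebius tau b (e t)).
Proof.
  split; [split; [| split; [| split]] |].
  - intros t Ht. split.
    + intros z Hz. eexists. now apply moebius_derive.
    + intros z Hz. now apply flow_disc.
  - intros z _. rewrite (flow_0 _ _ _ He). apply moebius_0.
  - intros s t z Hs Ht Hz. now apply flow_semigroup_law.
  - intros K _ HK eps. generalize (flow_near_identity eps). apply filter_imp. auto.
  - intros t Ht. split; [| split].
    + exists (1 - e t), (e t * tau), (- (e t * b)), (1 + e t * b * tau). split.
      * rewrite Cmod_opp. now apply (flow_pole _ _ _ He).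
      * intros z _. apply moebius_linear_fractional.
    + intros [k Hk].
      assert (D0 : disc 0) by (unfold disc; rewrite Cmod_0; lra).
      assert (D1 : disc (RtoC (/ 2))) by (unfold disc; rewrite Cmod_R, Rabs_right; lra).
      assert (E : (0 : C) = RtoC (/ 2)).
      { apply (moebius_injective tau b (e t)); [apply (flow_mult _ _ _ He) | | |].
        1, 2: now apply flow_den. now rewrite !Hk. }
      apply RtoC_inj in E. lra.
    + intros z Hz. now apply flow_disc.
Qed.

Lemma flow_nontrivial (t : R) : (0 <= t)%R -> e t <> 0 ->
  ~ trivial_semigroup (fun t => moebius tau b (e t)).
Proof.
  intros Ht Hne H.
  assert (Hz : exists z, disc z /\ z <> tau).
  { destruct (Ceq_dec tau 0) as [-> | E].
    - exists (RtoC (/ 2)). split; [unfold disc; rewrite Cmod_R, Rabs_right; lra |].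
      intros E. apply RtoC_inj in E. lra.
    - exists 0. split; [unfold disc; rewrite Cmod_0; lra | congruence]. }
  destruct Hz as (z & Hz & Hzt).
  pose proof (flow_den t z Ht Hz) as Hn.
  pose proof (H t z Ht Hz) as E. simpl in E.
  assert (E' : e t * ((z - tau) * (1 - b * z)) = 0).
  { replace (e t * ((z - tau) * (1 - b * z))) with
      (- ((moebius tau b (e t) z - z) * (1 - e t * b * (z - tau)))) by (unfold moebius; now field).
    rewrite E. ring. }
  revert E'. repeat apply Cmult_neq_0; [assumption | now apply Cminus_eq_contra |].
  apply one_minus_neq_0, Cmod_mult_lt_1; [apply (flow_b _ _ _ He) | assumption].
Qed.

End Flow.

Lemma moebius_boundary (f : C -> C) (tau b e : C) :
  circle tau -> (forall z, disc z -> f z = moebius tau b e z) ->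
  boundary_fixed f tau /\ boundary_derivative f tau (1 - e * (1 - b * tau)).
Proof.
  intros Htau Hf.
  assert (E1 : (- (e * b)) * tau + (1 + e * b * tau) = 1) by ring.
  assert (Hn : (- (e * b)) * tau + (1 + e * b * tau) <> 0) by (rewrite E1; apply C1_nz).
  assert (E : forall z, disc z -> f z =
    ((1 - e) * z + e * tau) / ((- (e * b)) * z + (1 + e * b * tau)))
    by (intros; rewrite Hf by assumption; apply moebius_linear_fractional).
  pose proof (boundary_value_linear_fractional _ _ _ _ _ tau Htau Hn E) as H1.
  pose proof (boundary_derivative_linear_fractional _ _ _ _ _ tau Htau Hn E) as H2.
  rewrite E1 in H1, H2. split.
  - replace (((1 - e) * tau + e * tau) / 1) with tau in H1 by field. exact H1.
  - replace (((1 - e) * (1 + e * b * tau) - e * tau * - (e * b)) / (1 * 1)) with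
      (1 - e * (1 - b * tau)) in H2 by field. exact H2.
Qed.

(** * Dilations and translations preserve the disc *)

Lemma Cmod_le_1_sq (b : C) : (Cmod b <= 1)%R -> (fst b * fst b + snd b * snd b <= 1)%R.
Proof. rewrite <- Cmod_sq. pose proof (Cmod_ge_0 b). nra. Qed.

Lemma Cmod_lt_1_sq (b : C) : (Cmod b < 1)%R -> (fst b * fst b + snd b * snd b < 1)%R.
Proof. rewrite <- Cmod_sq. pose proof (Cmod_ge_0 b). nra. Qed.

Lemma sq_pos_of_neq_0 (z : C) : z <> 0 -> (0 < fst z * fst z + snd z * snd z)%R.
Proof. rewrite <- Cmod_sq. intros H. apply Cmod_gt_0 in H. nra. Qed.

(** Up to the factor [1 - b tau], these are the numerator and the denominator of the dilation with
multiplier [s]. In the coordinate [v = (z - tau) / (1 - b z)], the image of the disc is where [|1 +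
b v|^2 - |tau + v|^2] is positive, and this quadratic expression is concave along rays because [|b|
<= 1] and nonnegative at [v = 0] because [|tau| <= 1]: the region is stable under [v -> s v]. The
identity in the proof makes the concavity explicit. *)
Lemma dilation_self_map (tau b z : C) (s : R) :
  (Cmod tau <= 1)%R -> (Cmod b <= 1)%R -> disc z -> 1 - b * tau <> 0 -> (0 < s <= 1)%R ->
  (Cmod ((1 - b * tau) * z - RtoC (1 - s) * (z - tau)) <
   Cmod ((1 - b * tau) - RtoC (1 - s) * b * (z - tau)))%R.
Proof.
  intros Ht Hb Hz Hu Hs. apply Cmod_lt_of_sq. apply Rlt_0_minus.
  apply Cmod_le_1_sq in Ht, Hb. apply Cmod_lt_1_sq in Hz.
  apply sq_pos_of_neq_0 in Hu.
  destruct z as [z1 z2], tau as [t1 t2], b as [b1 b2]. simpl in *.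
  match goal with |- (0 < ?X)%R =>
    replace X with
    ((1 - s) * ((1 - (t1 * t1 + t2 * t2)) *
        ((1 - (b1 * z1 - b2 * z2)) * (1 - (b1 * z1 - b2 * z2)) +
         (b1 * z2 + b2 * z1) * (b1 * z2 + b2 * z1)))
     + s * ((1 - (z1 * z1 + z2 * z2)) *
        ((1 + - (b1 * t1 - b2 * t2)) * (1 + - (b1 * t1 - b2 * t2)) +
         (0 + - (b1 * t2 + b2 * t1)) * (0 + - (b1 * t2 + b2 * t1))))
     + s * (1 - s) * ((1 - (b1 * b1 + b2 * b2)) *
        ((z1 - t1) * (z1 - t1) + (z2 - t2) * (z2 - t2))))%R by ring
  end.
  assert (Hsq : forall x y : R, (0 <= x * x + y * y)%R) by (intros; nra).
  apply Rplus_lt_le_0_compat; [apply Rplus_le_lt_0_compat |].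
  - apply Rmult_le_pos; [lra |]. apply Rmult_le_pos; [lra | apply Hsq].
  - apply Rmult_lt_0_compat; [lra |]. apply Rmult_lt_0_compat; lra.
  - apply Rmult_le_pos; [nra |]. apply Rmult_le_pos; [lra | apply Hsq].
Qed.

(** With [u = b tau], the difference of the squares is at least [s |1 - u|^2 + s (1 - s) (1 -
|u|^2)], which is positive for [|u| <= 1] and [u <> 1]. *)
Lemma dilation_pole (tau b : C) (s : R) :
  (Cmod tau <= 1)%R -> (Cmod b <= 1)%R -> 1 - b * tau <> 0 -> (0 < s <= 1)%R ->
  (Cmod (RtoC (1 - s) * b) < Cmod ((1 - b * tau) + RtoC (1 - s) * b * tau))%R.
Proof.
  intros Ht Hb Hu Hs.
  assert (Hbt : (Cmod (b * tau) <= 1)%R).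
  { rewrite Cmod_mult. pose proof (Cmod_ge_0 b). pose proof (Cmod_ge_0 tau). nra. }
  apply Rle_lt_trans with (Cmod (RtoC (1 - s))).
  { rewrite Cmod_mult. pose proof (Cmod_ge_0 (RtoC (1 - s))). nra. }
  replace ((1 - b * tau) + RtoC (1 - s) * b * tau) with (1 - RtoC s * (b * tau))
    by (rewrite RtoC_minus; ring).
  apply Cmod_lt_of_sq. apply Cmod_le_1_sq in Hbt. apply sq_pos_of_neq_0 in Hu.
  destruct (b * tau) as [x y]. simpl in *.
  apply Rlt_0_minus.
  match goal with |- (0 < ?X)%R =>
    replace X with (s * ((1 + - x) * (1 + - x) + (0 + - y) * (0 + - y))
                    + s * (1 - s) * (1 - (x * x + y * y)))%R by ring
  end.
  apply Rplus_lt_le_0_compat; [apply Rmult_lt_0_compat; lra |].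
  apply Rmult_le_pos; nra.
Qed.

Lemma dilation_flow (tau b : C) (k : R) :
  (Cmod tau <= 1)%R -> (Cmod b <= 1)%R -> 1 - b * tau <> 0 -> (k < 0)%R ->
  flow_parameter tau b (fun t => RtoC (1 - exp (k * t)) / (1 - b * tau)).
Proof.
  intros Ht Hb Hu Hk.
  assert (Hm : (0 < Cmod (1 - b * tau))%R) by now apply Cmod_gt_0.
  assert (Hs : forall t, (0 <= t)%R -> (0 < exp (k * t) <= 1)%R).
  { intros t Ht'. split; [apply exp_pos |]. rewrite <- exp_0.
    destruct (Req_dec t 0) as [-> | Hn]; [right; f_equal; ring |].
    left. apply exp_increasing. nra. }
  split; try assumption.
  - rewrite Rmult_0_r, exp_0. replace (1 - 1)%R with 0%R by ring. now field.
  - intros s t _ _. rewrite Rmult_plus_distr_l, exp_plus, 3!RtoC_minus, RtoC_mult. now field.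
  - replace (0 : C) with (RtoC (1 - exp (k * 0)) / (1 - b * tau))
      by (rewrite Rmult_0_r, exp_0; replace (1 - 1)%R with 0%R by ring; now field).
    apply clim_div; [| apply clim_const | assumption].
    apply clim_RtoC. intros P HP. apply filter_le_within.
    revert P HP. apply (ex_derive_continuous (fun t : R => 1 - exp (k * t))%R).
    auto_derive. exact I.
  - intros t. replace (1 - RtoC (1 - exp (k * t)) / (1 - b * tau) * (1 - b * tau))
      with (RtoC (exp (k * t))) by (rewrite RtoC_minus; field; assumption).
    intros E. apply RtoC_inj in E. pose proof (exp_pos (k * t)). lra.
  - intros t Ht'.
    apply Rmult_lt_reg_r with (Cmod (1 - b * tau)); [assumption |].
    rewrite <- 2!Cmod_mult.
    pose proof (dilation_pole tau b _ Ht Hb Hu (Hs t Ht')) as H.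
    match goal with |- (Cmod ?x < Cmod ?y)%R =>
      replace x with (RtoC (1 - exp (k * t)) * b) by (field; assumption);
      replace y with ((1 - b * tau) + RtoC (1 - exp (k * t)) * b * tau) by (field; assumption)
    end.
    exact H.
  - intros t z Ht' Hz.
    apply Rmult_lt_reg_r with (Cmod (1 - b * tau)); [assumption |].
    rewrite <- 2!Cmod_mult.
    pose proof (dilation_self_map tau b z _ Ht Hb Hz Hu (Hs t Ht')) as H.
    match goal with |- (Cmod ?x < Cmod ?y)%R =>
      replace x with ((1 - b * tau) * z - RtoC (1 - exp (k * t)) * (z - tau)) by (field; assumption);
      replace y with ((1 - b * tau) - RtoC (1 - exp (k * t)) * b * (z - tau)) by (field; assumption)
    end.
    exact H.
Qed.

(** The difference between the squared moduli of the denominator and of the numerator is [(1 -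
|z|^2) + 2 (Re e) |z - tau|^2]. *)
Lemma parabolic_flow (tau m : C) :
  circle tau -> (0 <= Re m)%R ->
  flow_parameter tau (Cconj tau) (fun t => RtoC t * m).
Proof.
  intros Ht Hm.
  pose proof (circle_conj tau Ht) as Hc. rewrite Cmult_comm in Hc.
  assert (Htm : forall t, (0 <= t)%R -> (0 <= Re (RtoC t * m))%R).
  { intros t Ht'. rewrite re_scal_l. now apply Rmult_le_pos. }
  split.
  - right. exact Ht.
  - rewrite Cmod_conj. right. exact Ht.
  - ring.
  - intros s t _ _. rewrite Hc, RtoC_plus. ring.
  - rewrite <- (Cmult_0_l m). apply clim_mult; [| apply clim_const].
    apply clim_RtoC. intros P HP. now apply filter_le_within.
  - intros t. rewrite Hc. replace (1 - RtoC t * m * (1 - 1)) with (1 : C) by ring. apply C1_nz.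
  - intros t Ht'. rewrite <- (Cmult_assoc _ _ tau), Hc, Cmod_mult, Cmod_conj, Ht, Rmult_1_r, Cmult_1_r.
    specialize (Htm t Ht'). apply Cmod_lt_of_sq. destruct (RtoC t * m) as [x y].
    unfold Re in Htm. simpl in *. nra.
  - intros t z Ht' Hz. specialize (Htm t Ht'). apply Cmod_lt_of_sq. apply Rlt_0_minus.
    apply Cmod_lt_1_sq in Hz. unfold circle in Ht.
    assert (Ht2 : (fst tau * fst tau + snd tau * snd tau = 1)%R) by (rewrite <- Cmod_sq, Ht; ring).
    destruct (RtoC t * m) as [x y], tau as [t1 t2], z as [z1 z2]. unfold Re in Htm. simpl in *.
    match goal with |- (0 < ?X)%R =>
      replace X with ((1 - (z1 * z1 + z2 * z2))
        + 2 * x * ((z1 - t1) * (z1 - t1) + (z2 - t2) * (z2 - t2))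
        + ((t1 * t1 + t2 * t2) - 1) * ((x * x + y * y) *
            ((z1 - t1) * (z1 - t1) + (z2 - t2) * (z2 - t2))))%R by ring
    end.
    rewrite Ht2. assert (0 <= (z1 - t1) * (z1 - t1) + (z2 - t2) * (z2 - t2))%R as HY
      by (apply Rplus_le_le_0_compat; apply Rle_0_sqr).
    pose proof (Rmult_le_pos _ _ Htm HY). lra.
Qed.

(** * Semigroups with a given Koenigs function *)

Lemma Cmod_sphere_inv (beta : sphere) : outside_disc beta -> (Cmod (sphere_inv beta) <= 1)%R.
Proof.
  destruct beta as [z |]; simpl; intros H.
  - unfold disc in H. assert (Hz : (1 <= Cmod z)%R) by lra.
    rewrite Cmod_inv by (apply Cmod_gt_0; lra).
    rewrite <- Rinv_1. apply Rinv_le_contravar; lra.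
  - rewrite Cmod_0. lra.
Qed.

Lemma disc_0 : disc 0.
Proof. unfold disc. rewrite Cmod_0. lra. Qed.

Lemma one_minus_mult_neq_0 (b z : C) : (Cmod b <= 1)%R -> disc z -> 1 - b * z <> 0.
Proof. intros Hb Hz. now apply one_minus_neq_0, Cmod_mult_lt_1. Qed.

Lemma quotient_injective (tau b z w : C) :
  1 - b * tau <> 0 -> 1 - b * z <> 0 -> 1 - b * w <> 0 ->
  (z - tau) / (1 - b * z) = (w - tau) / (1 - b * w) -> z = w.
Proof.
  intros Hu Hz Hw E.
  assert (H : (z - w) * (1 - b * tau) = 0).
  { replace ((z - w) * (1 - b * tau)) with
      (((z - tau) / (1 - b * z) - (w - tau) / (1 - b * w)) * ((1 - b * z) * (1 - b * w)))
      by (field; now split).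
    rewrite E. ring. }
  destruct (Ceq_dec (z - w) 0) as [E0 | E0]; [now apply Ceq_minus |].
  exfalso. now apply (Cmult_neq_0 _ _ E0 Hu).
Qed.

Lemma moebius_quotient (tau b e z : C) :
  1 - e * b * (z - tau) <> 0 -> 1 - b * z <> 0 ->
  (moebius tau b e z - tau) / (1 - b * moebius tau b e z) =
  (1 - e * (1 - b * tau)) * ((z - tau) / (1 - b * z)).
Proof.
  intros Hn Hz. rewrite moebius_minus_tau, one_minus_moebius by assumption. field. now split.
Qed.

Lemma Cexp_RtoC (x : R) : Cexp (RtoC x) = RtoC (exp x).
Proof.
  unfold Cexp, Re, Im. simpl. rewrite cos_0, sin_0. unfold RtoC. f_equal; ring.
Qed.

Lemma derive_quadratic (p q r z : C) :
  C_is_derive (fun w => p + q * w + r * (w * w)) z (q + 2 * r * z).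
Proof.
  apply (derive_of_slope _ (fun w => q + r * (w + z))).
  - apply filter_forall. intros w. ring.
  - replace (q + 2 * r * z) with (q + r * (z + z)) by ring.
    apply clim_plus; [apply clim_const |]. apply clim_mult; [apply clim_const |].
    apply clim_plus; [apply clim_id | apply clim_const].
Qed.

Lemma within_nonneg_proper (t : R) :
  (0 <= t)%R -> ProperFilter (within (fun s => (0 <= s)%R) (locally t)).
Proof.
  intros Ht. split; [| typeclasses eauto].
  intros P HP. exists t. now apply (locally_singleton t _ HP).
Qed.

Lemma moebius_path_derive (tau b z : C) (k t : R) :
  1 - b * tau <> 0 ->
  let e s := RtoC (1 - exp (k * s)) / (1 - b * tau) in
  1 - e t * b * (z - tau) <> 0 ->
  @is_derive R_AbsRing C_R_NormedModule (fun s : R => moebius tau b (e s) z) t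
    (RtoC (k * exp (k * t)) * ((z - tau) * (1 - b * z) /
      ((1 - b * tau) * ((1 - e t * b * (z - tau)) * (1 - e t * b * (z - tau)))))).
Proof.
  intros Hu e Hn.
  set (e' := fun x : R => RtoC (1 - x) / (1 - b * tau)).
  set (D := fun x : R => 1 - e' x * b * (z - tau)).
  set (d := (z - tau) * (1 - b * z) / ((1 - b * tau) * (D (exp (k * t)) * D (exp (k * t))))).
  rewrite <- scal_R_Cmult.
  apply (@is_derive_comp R_AbsRing C_R_NormedModule (fun x : R => moebius tau b (e' x) z)
           (fun s => exp (k * s)) t d (k * exp (k * t))%R).
  2: { auto_derive; [exact I | ring]. }
  assert (HD : forall x : R, clim (locally x) D (D x)).
  { intros x. apply clim_minus; [apply clim_const |].
    apply clim_mult; [| apply clim_const]. apply clim_mult; [| apply clim_const].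
    apply clim_div; [| apply clim_const | assumption].
    apply clim_RtoC. apply (ex_derive_continuous (fun y : R => 1 - y)%R). auto_derive. exact I. }
  set (x := exp (k * t)).
  apply (path_derive_of_slope (locally x) (fun y : R => moebius tau b (e' y) z)
    (fun y => (z - tau) * (1 - b * z) / ((1 - b * tau) * (D x * D y))) x).
  - apply filter_le_refl.
  - generalize (clim_neq _ _ 0 (HD x) Hn). apply filter_imp. intros y Hy.
    replace (moebius tau b (e' y) z) with
      (moebius tau b (e' x) z + (moebius tau b (e' y) z - moebius tau b (e' x) z)) by ring.
    rewrite moebius_minus_moebius by assumption. fold (D y) (D x).
    unfold e'. rewrite !RtoC_minus. field. repeat split; assumption.
  - apply clim_div; [apply clim_const | |].
    + apply clim_mult; [apply clim_const |]. apply clim_mult; [apply clim_const | apply HD].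
    + repeat apply Cmult_neq_0; assumption.
Qed.

(** The image of the disc under [h] is a disc or a half-plane containing [0], so the dilations by
[exp (- t)] preserve it, whatever the second fixed point. *)
Lemma elliptic_model (h : C -> C) (h_holo : holomorphic h) (tau : C) (beta : sphere) :
  disc tau -> outside_disc beta ->
  (forall z, disc z -> h z = (1 - sphere_inv beta * tau) *
              ((z - tau) / (1 - sphere_inv beta * z))) ->
  exists phi : R -> C -> C,
    linear_fractional_semigroup phi /\ elliptic phi /\
    ~ trivial_semigroup phi /\ koenigs_function phi h.
Proof.
  intros Ht Hbeta Hh. apply Cmod_sphere_inv in Hbeta.
  revert Hh Hbeta. generalize (sphere_inv beta). clear beta. intros b Hh Hb.
  pose proof (one_minus_mult_neq_0 b tau Hb Ht) as Hu.
  set (e := fun t => RtoC (1 - exp (-1 * t)) / (1 - b * tau)).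
  assert (He : flow_parameter tau b e).
  { apply dilation_flow; [unfold disc in Ht; lra | assumption | assumption | lra]. }
  assert (Hmult : forall t, 1 - e t * (1 - b * tau) = RtoC (exp (-1 * t))).
  { intros t. unfold e. rewrite RtoC_minus. now field. }
  assert (Hnt : ~ trivial_semigroup (fun t => moebius tau b (e t))).
  { apply (flow_nontrivial tau b e He 1); [lra |].
    intros E. specialize (Hmult 1%R). rewrite E, Cmult_0_l, Rmult_1_r in Hmult.
    assert (E1 : 1 - 0 = RtoC 1) by ring. rewrite E1 in Hmult. apply RtoC_inj in Hmult.
    pose proof (exp_increasing (-1) 0 ltac:(lra)). rewrite exp_0 in H. lra. }
  assert (Hell : elliptic_at (fun t => moebius tau b (e t)) tau).
  { split; [assumption |]. intros t _. apply moebius_fixed_point. }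
  exists (fun t => moebius tau b (e t)).
  split; [now apply flow_linear_fractional_semigroup |].
  split; [split; [assumption | now exists tau] |].
  split; [assumption |].
  split.
  { split; [assumption |]. intros z w Hz Hw E. rewrite !Hh in E by assumption.
    apply (quotient_injective tau b); try assumption; try now apply one_minus_mult_neq_0.
    apply (f_equal (fun x => / (1 - b * tau) * x)) in E.
    now rewrite !Cmult_assoc, Cinv_l, !Cmult_1_l in E. }
  exists tau. split; [split; [assumption | now left] |].
  left. split; [assumption |]. split; [rewrite Hh by assumption; field; assumption |].
  split.
  { apply is_C_derive_unique.
    apply (derive_ext_disc (fun w => ((1 - b * tau) * w + - ((1 - b * tau) * tau)) / (- b * w + 1)));
      [assumption | |].
    - intros w Hw. rewrite Hh by assumption.
      pose proof (one_minus_mult_neq_0 b w Hb Hw) as Hw'.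
      replace (- b * w + 1) with (1 - b * w) by ring. now field.
    - pose proof (derive_linear_fractional (1 - b * tau) (- ((1 - b * tau) * tau)) (- b) 1 tau) as D.
      replace (- b * tau + 1) with (1 - b * tau) in D by ring.
      replace (((1 - b * tau) * 1 - - ((1 - b * tau) * tau) * - b) /
        ((1 - b * tau) * (1 - b * tau))) with (1 : C) in D by now field.
      now apply D. }
  (* The generator is [- (z - tau) (1 - b z) / (1 - b tau)], whose derivative at [tau] is [- 1].
  *)
  set (p := tau / (1 - b * tau)). set (q := - (1 + b * tau) / (1 - b * tau)).
  set (r := b / (1 - b * tau)).
  set (G := fun w => p + q * w + r * (w * w)).
  assert (HG : forall w, G w = - ((w - tau) * (1 - b * w) / (1 - b * tau))).
  { intros w. unfold G, p, q, r. now field. }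
  exists G. split.
  - split.
    + intros z _. eexists. apply derive_quadratic.
    + intros t z Ht' Hz.
      pose proof (flow_den tau b e He t z Ht' Hz) as Hn.
      pose proof (within_nonneg_proper t Ht') as FF.
      apply (@filterdiff_locally R_AbsRing R_NormedModule C_R_NormedModule _ FF _ t).
      * intros P HP. now apply filter_le_within.
      * rewrite HG, moebius_minus_tau, one_minus_moebius by assumption.
        replace (- ((1 - e t * (1 - b * tau)) * (z - tau) / (1 - e t * b * (z - tau)) *
          ((1 - b * z) / (1 - e t * b * (z - tau))) / (1 - b * tau))) with
         (RtoC (-1 * exp (-1 * t)) * ((z - tau) * (1 - b * z) /
          ((1 - b * tau) * ((1 - e t * b * (z - tau)) * (1 - e t * b * (z - tau)))))).
        -- now apply moebius_path_derive.
        -- rewrite Hmult, RtoC_mult. field. now split.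
  - intros t z Ht' Hz.
    assert (ED : C_derive (moebius tau b (e t)) tau = RtoC (exp (-1 * t))).
    { apply is_C_derive_unique. rewrite <- Hmult.
      pose proof (moebius_derive tau b e He t tau Ht' Ht) as D.
      replace (tau - tau) with (0 : C) in D by ring.
      rewrite Cmult_0_r in D.
      replace ((1 - e t * (1 - b * tau)) / ((1 - 0) * (1 - 0)))
        with (1 - e t * (1 - b * tau)) in D by field.
      exact D. }
    assert (EG : C_derive G tau = RtoC (-1)).
    { apply is_C_derive_unique. replace (RtoC (-1)) with (q + 2 * r * tau).
      - apply derive_quadratic.
      - unfold q, r. now field. }
    rewrite ED, EG, <- RtoC_mult, Cexp_RtoC. split; [| reflexivity].
    rewrite !Hh by (assumption || now apply flow_disc).
    rewrite moebius_quotient.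
    + rewrite Hmult. ring.
    + now apply flow_den.
    + now apply one_minus_mult_neq_0.
Qed.

(** Positive real factors do not change the principal argument. *)
Lemma Clog_scale (s : R) (w : C) :
  (0 < s)%R -> w <> 0 -> Clog (RtoC s * w) = RtoC (ln s) + Clog w.
Proof.
  intros Hs Hw.
  assert (Hm : (0 < Cmod w)%R) by now apply Cmod_gt_0.
  assert (EC : Cmod (RtoC s * w) = (s * Cmod w)%R) by (rewrite Cmod_mult, Cmod_R, Rabs_right; lra).
  assert (EA : Carg (RtoC s * w) = Carg w).
  { unfold Carg. rewrite EC, im_scal_l, re_scal_l.
    replace (s * Re w / (s * Cmod w))%R with (Re w / Cmod w)%R by (field; lra).
    destruct (Rle_dec 0 (s * Im w)), (Rle_dec 0 (Im w)); try reflexivity; exfalso; nra. }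
  unfold Clog. rewrite EC, EA, ln_mult by assumption.
  unfold Cplus, RtoC. simpl. f_equal. ring.
Qed.

Lemma Clog_injective (z w : C) : z <> 0 -> w <> 0 -> Clog z = Clog w -> z = w.
Proof.
  intros Hz Hw E.
  rewrite <- (proj1 (Clog_principal z Hz)), <- (proj1 (Clog_principal w Hw)). now rewrite E.
Qed.

Lemma Clog_1 : Clog 1 = 0.
Proof.
  unfold Clog, Carg. rewrite Cmod_1, ln_1.
  replace (Re 1 / 1)%R with 1%R by (unfold Re, RtoC; simpl; field).
  rewrite acos_1. unfold Im, RtoC. simpl. destruct (Rle_dec 0 0); [reflexivity | lra].
Qed.

Lemma sphere_inv_mult_neq_1 (tau : C) (beta : sphere) :
  outside_disc beta -> beta <> Fin tau -> 1 - sphere_inv beta * tau <> 0.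
Proof.
  intros Hbeta Hne. destruct beta as [z |]; simpl in *.
  - assert (Hz : z <> 0) by (intros ->; apply Hbeta, disc_0).
    intros E. apply Hne. f_equal.
    replace z with (z * (1 - / z * tau) + tau) by now field. rewrite E. ring.
  - intros E. apply C1_nz. rewrite <- E. ring.
Qed.

Lemma boundary_ratio (tau b z : C) :
  circle tau -> (1 - Cconj tau * z) / (1 - b * z) = - Cconj tau * ((z - tau) / (1 - b * z)).
Proof.
  intros Ht. pose proof (circle_conj tau Ht) as Hc.
  replace (1 - Cconj tau * z) with (- Cconj tau * (z - tau)) by (rewrite <- Hc; ring).
  unfold Cdiv. ring.
Qed.

(** The argument of the logarithm is, up to a constant factor, the coordinate in which the Moebius
maps are dilations; a dilation of ratio [exp (t / alpha)] adds [t] to [alpha] times the logarithm,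
because the principal logarithm is additive for positive real factors. *)
Lemma hyperbolic_model (h : C -> C) (h_holo : holomorphic h) (alpha : R) (tau : C) (beta : sphere) :
  (alpha < 0)%R -> circle tau -> outside_disc beta -> beta <> Fin tau ->
  (forall z, disc z -> h z = RtoC alpha *
                Clog ((1 - Cconj tau * z) / (1 - sphere_inv beta * z))) ->
  exists phi : R -> C -> C,
    linear_fractional_semigroup phi /\ hyperbolic phi /\ koenigs_function phi h.
Proof.
  intros Ha Ht Hbeta Hne Hh. pose proof (sphere_inv_mult_neq_1 tau beta Hbeta Hne) as Hu.
  apply Cmod_sphere_inv in Hbeta. clear Hne.
  revert Hh Hbeta Hu. generalize (sphere_inv beta). clear beta. intros b Hh Hb Hu.
  assert (Hk : (/ alpha < 0)%R) by now apply Rinv_lt_0_compat.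
  set (e := fun t => RtoC (1 - exp (/ alpha * t)) / (1 - b * tau)).
  assert (He : flow_parameter tau b e).
  { apply dilation_flow; try assumption. right. exact Ht. }
  assert (Hmult : forall t, 1 - e t * (1 - b * tau) = RtoC (exp (/ alpha * t))).
  { intros t. unfold e. rewrite RtoC_minus. now field. }
  assert (Hlt : forall t, (0 < t)%R -> (exp (/ alpha * t) < 1)%R).
  { intros t Ht'. rewrite <- exp_0. apply exp_increasing. nra. }
  assert (Hnt : ~ trivial_semigroup (fun t => moebius tau b (e t))).
  { apply (flow_nontrivial tau b e He 1); [lra |].
    intros E. specialize (Hmult 1%R). rewrite E, Cmult_0_l in Hmult.
    assert (E1 : 1 - 0 = RtoC 1) by ring. rewrite E1 in Hmult. apply RtoC_inj in Hmult.
    specialize (Hlt 1%R Rlt_0_1). lra. }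
  assert (Hhyp : hyperbolic_at (fun t => moebius tau b (e t)) tau).
  { split; [assumption |]. intros t Ht'.
    destruct (moebius_boundary (moebius tau b (e t)) tau b (e t) Ht (fun z _ => eq_refl))
      as [H1 H2].
    rewrite Hmult in H2.
    split; [assumption |]. exists (exp (/ alpha * t)). auto. }
  assert (Hconj : - Cconj tau <> 0).
  { intros E. apply (f_equal Cmod) in E. rewrite Cmod_opp, Cmod_conj, Ht, Cmod_0 in E. lra. }
  assert (Hquot : forall z, disc z -> - Cconj tau * ((z - tau) / (1 - b * z)) <> 0).
  { intros z Hz. apply Cmult_neq_0; [assumption |].
    apply Cmult_neq_0.
    - now apply Cminus_eq_contra, disc_circle_neq.
    - intros E. apply C1_nz. pose proof (one_minus_mult_neq_0 b z Hb Hz) as H.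
      rewrite <- (Cinv_r _ H), E. ring. }
  assert (Ha0 : RtoC alpha <> 0) by (intros E; apply RtoC_inj in E; lra).
  exists (fun t => moebius tau b (e t)).
  split; [now apply flow_linear_fractional_semigroup |].
  split; [split; [assumption | now exists tau] |].
  split.
  { split; [assumption |]. intros z w Hz Hw E. rewrite !Hh in E by assumption.
    apply (f_equal (fun x => / RtoC alpha * x)) in E.
    rewrite !Cmult_assoc, Cinv_l, !Cmult_1_l in E by assumption.
    rewrite !(boundary_ratio tau) in E by assumption.
    apply Clog_injective in E; [| now apply Hquot | now apply Hquot].
    apply (quotient_injective tau b); try assumption; try now apply one_minus_mult_neq_0.
    apply (f_equal (fun x => / (- Cconj tau) * x)) in E.
    now rewrite !Cmult_assoc, Cinv_l, !Cmult_1_l in E. }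
  exists tau. split; [split; [assumption | right; now left] |].
  right. split; [assumption |]. split.
  - rewrite Hh by apply disc_0. rewrite !Cmult_0_r.
    replace ((1 - 0) / (1 - 0)) with (1 : C) by field.
    rewrite Clog_1. ring.
  - intros t z Ht' Hz.
    rewrite !Hh by (assumption || now apply flow_disc).
    rewrite !(boundary_ratio tau) by assumption.
    rewrite moebius_quotient; [| now apply flow_den | now apply one_minus_mult_neq_0].
    rewrite Hmult.
    replace (- Cconj tau * (RtoC (exp (/ alpha * t)) * ((z - tau) / (1 - b * z)))) with
      (RtoC (exp (/ alpha * t)) * (- Cconj tau * ((z - tau) / (1 - b * z)))) by ring.
    rewrite Clog_scale; [| apply exp_pos | now apply Hquot].
    rewrite ln_exp, RtoC_mult, RtoC_inv by lra. now field.
Qed.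

(** As [z / (z - tau) = 1 + tau / (z - tau)], adding [t] to [h] is a translation in the coordinate
[1 / (z - tau)]. *)
Lemma parabolic_model (h : C -> C) (h_holo : holomorphic h) (alpha tau : C) :
  alpha <> 0 -> (Re alpha <= 0)%R -> circle tau ->
  (forall z, disc z -> h z = alpha * (z / (z - tau))) ->
  exists phi : R -> C -> C,
    linear_fractional_semigroup phi /\ parabolic phi /\ koenigs_function phi h.
Proof.
  intros Ha Hre Ht Hh.
  pose proof (circle_conj tau Ht) as Hc. rewrite Cmult_comm in Hc.
  set (m := - / alpha).
  assert (Hm : (0 <= Re m)%R).
  { unfold m. apply sq_pos_of_neq_0 in Ha. destruct alpha as [x y]. unfold Re in *. simpl in *.
    assert (0 <= - x / (x * (x * 1) + y * (y * 1)))%R.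
    { apply Rmult_le_pos; [lra |]. left. apply Rinv_0_lt_compat. lra. }
    unfold Rdiv in *. lra. }
  pose proof (parabolic_flow tau m Ht Hm) as He.
  set (b := Cconj tau) in *. set (e := fun t => RtoC t * m) in *.
  assert (Hmult : forall t, 1 - e t * (1 - b * tau) = 1) by (intros t; rewrite Hc; ring).
  assert (Hnt : ~ trivial_semigroup (fun t => moebius tau b (e t))).
  { apply (flow_nontrivial tau b e He 1); [lra |]. unfold e, m. rewrite Cmult_1_l.
    intros E. apply C1_nz. rewrite <- (Cinv_r _ Ha).
    replace (/ alpha) with (- - / alpha) by ring. rewrite E. ring. }
  assert (Hpar : parabolic_at (fun t => moebius tau b (e t)) tau).
  { split; [assumption |]. intros t Ht'.
    destruct (moebius_boundary (moebius tau b (e t)) tau b (e t) Ht (fun z _ => eq_refl))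
      as [H1 H2].
    rewrite Hmult in H2. now split. }
  assert (Hz' : forall z, disc z -> z - tau <> 0).
  { intros z Hz. now apply Cminus_eq_contra, disc_circle_neq. }
  exists (fun t => moebius tau b (e t)).
  split; [now apply flow_linear_fractional_semigroup |].
  split; [split; [assumption | now exists tau] |].
  split.
  { split; [assumption |]. intros z w Hz Hw E. rewrite !Hh in E by assumption.
    pose proof (Hz' z Hz). pose proof (Hz' w Hw).
    assert (E' : tau * (z - w) = 0).
    { replace (tau * (z - w)) with
        (- (/ alpha * (alpha * (z / (z - tau)) - alpha * (w / (w - tau))) *
           ((z - tau) * (w - tau)))) by (field; repeat split; assumption).
      rewrite E. ring. }
    destruct (Ceq_dec (z - w) 0) as [E0 | E0]; [now apply Ceq_minus |].
    exfalso. now apply (Cmult_neq_0 _ _ (circle_neq_0 tau Ht) E0). }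
  exists tau. split; [split; [assumption | right; now right] |].
  right. split; [assumption |]. split.
  - rewrite Hh by apply disc_0. unfold Cdiv. ring.
  - intros t z Ht' Hz. pose proof (flow_den tau b e He t z Ht' Hz) as Hn.
    rewrite !Hh by (assumption || now apply flow_disc).
    rewrite moebius_minus_tau, Hmult by assumption. unfold moebius.
    pose proof (Hz' z Hz).
    replace (alpha * ((z - e t * (z - tau)) / (1 - e t * b * (z - tau)) /
      (1 * (z - tau) / (1 - e t * b * (z - tau))))) with
      (alpha * (z / (z - tau)) - alpha * e t) by (field; split; assumption).
    unfold e, m. field. split; assumption.
Qed.

(** * Coefficients of a semigroup of linear fractional maps *)

Lemma at_right_pos : at_right 0 (fun t : R => (0 < t)%R).
Proof. exists (mkposreal _ Rlt_0_1). auto. Qed.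

Lemma RtoC_neq_0 (t : R) : t <> 0%R -> RtoC t <> 0.
Proof. intros H E. now apply H, RtoC_inj. Qed.

Lemma den_neq_0 (c z : C) : (Cmod c < 1)%R -> (Cmod z <= 1)%R -> c * z + 1 <> 0.
Proof.
  intros Hc Hz. replace (c * z + 1) with (1 - (- c) * z) by ring.
  apply one_minus_neq_0. rewrite Cmod_mult, Cmod_opp.
  pose proof (Cmod_ge_0 c). pose proof (Cmod_ge_0 z). nra.
Qed.

(** As [|c| < |d|], the denominator may be divided by [d]; afterwards the pole lies outside the
closed disc, so the formula also makes sense on the unit circle. *)
Lemma self_map_normal_form (f : C -> C) :
  linear_fractional_self_map f ->
  exists a b c, (Cmod c < 1)%R /\ forall z, disc z -> f z = (a * z + b) / (c * z + 1).
Proof.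
  intros [(a & b & c & d & Hcd & Hf) _].
  pose proof (Cmod_ge_0 c) as Hc.
  assert (Hd : d <> 0) by (apply Cmod_gt_0; lra).
  assert (Hc1 : (Cmod (c / d) < 1)%R).
  { rewrite Cmod_div by assumption. apply Rmult_lt_reg_r with (Cmod d); [lra |].
    unfold Rdiv. rewrite Rmult_assoc, Rinv_l; lra. }
  exists (a / d), (b / d), (c / d). split; [assumption |].
  intros z Hz. rewrite Hf by assumption.
  assert (Hn : c / d * z + 1 <> 0) by (apply den_neq_0; [assumption | unfold disc in Hz; lra]).
  replace (c * z + d) with ((c / d * z + 1) * d) by now field.
  replace (a * z + b) with ((a / d * z + b / d) * d) by now field.
  field. split; [assumption |].
  intros E. apply Hn. replace (c / d * z + 1) with ((c * z + d) / d) by now field.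
  rewrite E. unfold Cdiv. ring.
Qed.

Record coefficients (phi : R -> C -> C) (a b c : R -> C) : Prop := {
  coef_c : forall t, (0 <= t)%R -> (Cmod (c t) < 1)%R;
  coef_eq : forall t z, (0 <= t)%R -> disc z -> phi t z = (a t * z + b t) / (c t * z + 1)
}.

Lemma coefficients_exist (phi : R -> C -> C) :
  linear_fractional_semigroup phi -> exists a b c, coefficients phi a b c.
Proof.
  intros [_ H].
  destruct (functional_choice (fun (t : R) (x : C * C * C) => (0 <= t)%R ->
    (Cmod (snd x) < 1)%R /\ forall z, disc z ->
      phi t z = (fst (fst x) * z + snd (fst x)) / (snd x * z + 1))) as [x Hx].
  - intros t. destruct (Rle_dec 0 t) as [Ht | Ht].
    + destruct (self_map_normal_form _ (H t Ht)) as (a & b & c & Hc & Hf).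
      exists (a, b, c). auto.
    + exists (RtoC 0, RtoC 0, RtoC 0). intros Ht'. contradiction.
  - exists (fun t => fst (fst (x t))), (fun t => snd (fst (x t))), (fun t => snd (x t)).
    split; intros; now apply (Hx t).
Qed.

Lemma semigroup_limit (phi : R -> C -> C) (z : C) :
  semigroup phi -> disc z -> clim (at_right 0) (fun t => phi t z) z.
Proof.
  intros (_ & _ & _ & H) Hz. apply clim_eps; [typeclasses eauto |]. intros eps.
  assert (Hcomp : compact_set (fun w => w = z)).
  { intros F _ Hcov. destruct (Hcov z eq_refl) as (U & HU & HzU).
    exists (U :: nil). split.
    - intros V [-> | []]. exact HU.
    - intros w ->. exists U. split; [now left | exact HzU]. }
  generalize (H (fun w => w = z) Hcomp (fun w E => eq_ind_r disc Hz E) eps).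
  apply filter_imp. intros t Ht. now apply Ht.
Qed.

Lemma disc_RtoC (x : R) : (Rabs x < 1)%R -> disc (RtoC x).
Proof. intros H. unfold disc. now rewrite Cmod_R. Qed.

(** Convergence of the maps to the identity gives convergence of the coefficients: [c t] is an
explicit rational function of the values of [phi t] at [0], [1 / 2] and [- 1 / 2]. *)
Lemma coefficients_pole_limit (phi : R -> C -> C) (a b c : R -> C) :
  semigroup phi -> coefficients phi a b c -> clim (at_right 0) c 0.
Proof.
  intros Hphi H.
  assert (Dp : disc (RtoC (/ 2))) by (apply disc_RtoC, Rabs_def1; lra).
  assert (Dm : disc (RtoC (- / 2))) by (apply disc_RtoC, Rabs_def1; lra).
  pose proof (semigroup_limit phi _ Hphi disc_0) as L0.
  pose proof (semigroup_limit phi _ Hphi Dp) as Lp.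
  pose proof (semigroup_limit phi _ Hphi Dm) as Lm.
  pose proof (clim_minus _ _ _ _ Lp Lm) as Ld.
  assert (E1 : RtoC (/ 2) - RtoC (- / 2) = 1) by (rewrite <- RtoC_minus; f_equal; lra).
  rewrite E1 in Ld.
  apply (clim_ext (fun t => (4 * phi t 0 - 2 * (phi t (RtoC (/ 2)) + phi t (RtoC (- / 2)))) /
    (phi t (RtoC (/ 2)) - phi t (RtoC (- / 2))))).
  - generalize (filter_and _ _ at_right_pos (clim_neq _ _ 0 Ld C1_nz)).
    apply filter_imp. intros t [Ht Hd].
    pose proof (coef_c _ _ _ _ H t (Rlt_le _ _ Ht)) as Hc.
    assert (Hnp : c t * RtoC (/ 2) + 1 <> 0)
      by (apply den_neq_0; [assumption | unfold disc in Dp; lra]).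
    assert (Hnm : c t * RtoC (- / 2) + 1 <> 0)
      by (apply den_neq_0; [assumption | unfold disc in Dm; lra]).
    assert (Ep : phi t (RtoC (/ 2)) * (c t * RtoC (/ 2) + 1) = a t * RtoC (/ 2) + b t).
    { rewrite (coef_eq _ _ _ _ H) by (assumption || lra). now field. }
    assert (Em : phi t (RtoC (- / 2)) * (c t * RtoC (- / 2) + 1) = a t * RtoC (- / 2) + b t).
    { rewrite (coef_eq _ _ _ _ H) by (assumption || lra). now field. }
    assert (E0 : phi t 0 = b t).
    { rewrite (coef_eq _ _ _ _ H) by (apply disc_0 || lra). field. }
    rewrite E0.
    (* Adding the equations at [1 / 2] and [- 1 / 2] eliminates [a]. *)
    assert (E2 : 4 * b t - 2 * (phi t (RtoC (/ 2)) + phi t (RtoC (- / 2))) =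
      c t * (phi t (RtoC (/ 2)) - phi t (RtoC (- / 2)))).
    { apply (f_equal2 Cplus) with (1 := Ep) in Em.
      rewrite RtoC_opp, RtoC_inv in * by lra.
      set (x := phi t (/ 2)) in *. set (y := phi t (- / 2)) in *.
      replace (4 * b t) with (2 * (a t * / 2 + b t + (a t * - / 2 + b t))) by ring.
      rewrite <- Em. field. }
    rewrite E2. now field.
  - apply (clim_value _ ((4 * 0 - 2 * (RtoC (/ 2) + RtoC (- / 2))) / 1)).
    + rewrite RtoC_opp. field.
    + apply clim_div; [| exact Ld | apply C1_nz].
      apply clim_minus; apply clim_mult; try apply clim_const; [exact L0 |].
      now apply clim_plus.
Qed.

(** * The generator is quadratic *)

(** The limits [p], [q], [r] are the coefficients of the generator [p + q z + r z^2]. *)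
Record infinitesimal_coefficients (phi : R -> C -> C) (a b c : R -> C) (p q r : C) : Prop := {
  inf_b : clim (at_right 0) (fun t => b t / RtoC t) p;
  inf_a : clim (at_right 0) (fun t => (a t - 1) / RtoC t) q;
  inf_c : clim (at_right 0) (fun t => - c t / RtoC t) r;
  inf_c0 : clim (at_right 0) c 0
}.

Definition orbit_slope (phi : R -> C -> C) (z : C) (t : R) : C := (phi t z - z) / RtoC t.

(** After clearing the denominator the mean speed of an orbit is quadratic in the starting point. *)
Lemma orbit_slope_numerator (phi : R -> C -> C) (a b c : R -> C) (t : R) (z : C) :
  coefficients phi a b c -> (0 < t)%R -> disc z ->
  orbit_slope phi z t * (c t * z + 1) =
    b t / RtoC t + (a t - 1) / RtoC t * z + - c t / RtoC t * (z * z).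
Proof.
  intros H Ht Hz. unfold orbit_slope.
  assert (Hn : c t * z + 1 <> 0).
  { apply den_neq_0; [apply (coef_c _ _ _ _ H); lra | unfold disc in Hz; lra]. }
  assert (Ht0 : RtoC t <> 0) by (apply RtoC_neq_0; lra).
  rewrite (coef_eq _ _ _ _ H) by (assumption || lra). field. now split.
Qed.

(** Lagrange interpolation: the coefficients of a quadratic polynomial are fixed linear combinations
of its values at three points, so they converge when these values do. *)
Lemma infinitesimal_coefficients_exist (phi : R -> C -> C) (a b c : R -> C)
  (z1 z2 z3 g1 g2 g3 : C) :
  semigroup phi -> coefficients phi a b c ->
  disc z1 -> disc z2 -> disc z3 -> z1 <> z2 -> z1 <> z3 -> z2 <> z3 ->
  clim (at_right 0) (orbit_slope phi z1) g1 ->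
  clim (at_right 0) (orbit_slope phi z2) g2 ->
  clim (at_right 0) (orbit_slope phi z3) g3 ->
  exists p q r, infinitesimal_coefficients phi a b c p q r.
Proof.
  intros Hphi H D1 D2 D3 N12 N13 N23 L1 L2 L3.
  pose proof (coefficients_pole_limit _ _ _ _ Hphi H) as Lc.
  assert (HQ : forall z g, clim (at_right 0) (orbit_slope phi z) g ->
    clim (at_right 0) (fun t => orbit_slope phi z t * (c t * z + 1)) g).
  { intros z g L. replace g with (g * (0 * z + 1)) by ring.
    apply clim_mult; [exact L |]. apply clim_plus; [| apply clim_const].
    apply clim_mult; [exact Lc | apply clim_const]. }
  apply HQ in L1, L2, L3. clear HQ.
  apply Cminus_eq_contra in N12, N13, N23.
  set (Q z := fun t => orbit_slope phi z t * (c t * z + 1)) in *.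
  (* [w1], [w2], [w3] are the weights of the second divided difference. *)
  set (w1 := / ((z1 - z2) * (z1 - z3))). set (w2 := - / ((z1 - z2) * (z2 - z3))).
  set (w3 := / ((z1 - z3) * (z2 - z3))).
  set (r := g1 * w1 + g2 * w2 + g3 * w3).
  set (q := (g1 - g2) * / (z1 - z2) - r * (z1 + z2)).
  exists (g1 - q * z1 - r * (z1 * z1)), q, r.
  assert (Lr : clim (at_right 0) (fun t => - c t / RtoC t) r).
  { apply (clim_ext (fun t => Q z1 t * w1 + Q z2 t * w2 + Q z3 t * w3)).
    - generalize at_right_pos. apply filter_imp. intros t Ht.
      pose proof (RtoC_neq_0 t ltac:(lra)).
      unfold Q, w1, w2, w3. rewrite !(orbit_slope_numerator phi a b c) by assumption. field.
      repeat split; assumption.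
    - repeat apply clim_plus; apply clim_mult; try assumption; apply clim_const. }
  assert (Lq : clim (at_right 0) (fun t => (a t - 1) / RtoC t) q).
  { apply (clim_ext (fun t => (Q z1 t - Q z2 t) * / (z1 - z2) - (- c t / RtoC t) * (z1 + z2))).
    - generalize at_right_pos. apply filter_imp. intros t Ht.
      pose proof (RtoC_neq_0 t ltac:(lra)).
      unfold Q. rewrite !(orbit_slope_numerator phi a b c) by assumption. field.
      repeat split; assumption.
    - apply clim_minus; apply clim_mult; try apply clim_const; [now apply clim_minus | exact Lr]. }
  split; [| exact Lq | exact Lr | exact Lc].
  apply (clim_ext (fun t => Q z1 t - (a t - 1) / RtoC t * z1 - - c t / RtoC t * (z1 * z1))).
  - generalize at_right_pos. apply filter_imp. intros t Ht.
    unfold Q. rewrite !(orbit_slope_numerator phi a b c) by assumption. ring.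
  - apply clim_minus; [apply clim_minus; [exact L1 |] |];
      apply clim_mult; try apply clim_const; assumption.
Qed.

Lemma orbit_slope_limit (phi : R -> C -> C) (a b c : R -> C) (p q r z : C) :
  coefficients phi a b c -> infinitesimal_coefficients phi a b c p q r -> disc z ->
  clim (at_right 0) (orbit_slope phi z) (p + q * z + r * (z * z)).
Proof.
  intros H [Lp Lq Lr Lc] Hz.
  apply (clim_ext (fun t => (b t / RtoC t + (a t - 1) / RtoC t * z + - c t / RtoC t * (z * z)) /
    (c t * z + 1))).
  - generalize at_right_pos. apply filter_imp. intros t Ht.
    rewrite <- (orbit_slope_numerator phi a b c) by assumption.
    field. apply den_neq_0; [apply (coef_c _ _ _ _ H); lra | unfold disc in Hz; lra].
  - replace (p + q * z + r * (z * z)) with ((p + q * z + r * (z * z)) / (0 * z + 1)) by field.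
    apply clim_div.
    + repeat apply clim_plus; try assumption; apply clim_mult; try assumption; apply clim_const.
    + apply clim_plus; [| apply clim_const]. apply clim_mult; [exact Lc | apply clim_const].
    + intros E. apply C1_nz. rewrite <- E. ring.
Qed.

(** The defining property of the generator at [t = 0], where it is a one-sided derivative. *)
Lemma generator_orbit_slope (phi : R -> C -> C) (G : C -> C) (z : C) :
  semigroup phi -> infinitesimal_generator phi G -> disc z ->
  clim (at_right 0) (orbit_slope phi z) (G z).
Proof.
  intros (_ & H0 & _) [_ HG] Hz.
  destruct (HG 0%R z (Rle_refl 0) Hz) as [_ HD].
  specialize (HD 0%R (fun P HP => filter_le_within _ P HP)).
  apply clim_eps; [typeclasses eauto |]. intros eps.
  generalize (HD (pos_div_2 eps)). unfold at_right, within. apply filter_imp.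
  intros t Ht Hpos. specialize (Ht (Rlt_le _ _ Hpos)).
  change (@norm R_AbsRing C_R_NormedModule (phi t z - phi 0%R z -
    (scal (t - 0)%R (G (phi 0%R z)) : C_R_NormedModule))%C <= eps / 2 * Rabs (t - 0))%R in Ht.
  rewrite scal_R_Cmult, <- Cmod_norm, H0, Rminus_0_r, (Rabs_right t) in Ht by (assumption || lra).
  assert (Ht0 : RtoC t <> 0) by (apply RtoC_neq_0; lra).
  unfold orbit_slope.
  replace ((phi t z - z) / RtoC t - G z) with ((phi t z - z - RtoC t * G z) / RtoC t) by now field.
  rewrite Cmod_div, Cmod_R, Rabs_right by (assumption || lra).
  apply Rmult_lt_reg_r with t; [assumption |].
  unfold Rdiv at 1. rewrite Rmult_assoc, Rinv_l by lra. pose proof (cond_pos eps). nra.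
Qed.

(** * Differentiating the functional equation *)

Lemma slope_chain_rule (phi : R -> C -> C) (h : C -> C) (z d g : C) :
  semigroup phi -> disc z -> C_is_derive h z d ->
  clim (at_right 0) (orbit_slope phi z) g ->
  clim (at_right 0) (fun t => (h (phi t z) - h z) / RtoC t) (d * g).
Proof.
  intros Hphi Hz Hd Lg. apply caratheodory in Hd. destruct Hd as (S & LS & ES).
  apply (clim_ext (fun t => S (phi t z) * orbit_slope phi z t)).
  - apply filter_forall. intros t. rewrite (ES (phi t z)). unfold orbit_slope, Cdiv. ring.
  - apply clim_mult; [| exact Lg]. apply clim_comp with z; [exact LS |].
    now apply semigroup_limit.
Qed.

(** The inverse function rule read along an orbit: [h] grows at unit speed, hence the orbit moves at
speed [1 / h' z]. *)
Lemma slope_inverse (phi : R -> C -> C) (h : C -> C) (z d : C) :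
  semigroup phi -> disc z -> C_is_derive h z d -> d <> 0 ->
  (forall t, (0 <= t)%R -> h (phi t z) = h z + RtoC t) ->
  clim (at_right 0) (orbit_slope phi z) (/ d).
Proof.
  intros Hphi Hz Hd Hd0 Hh. apply caratheodory in Hd. destruct Hd as (S & LS & ES).
  assert (LSphi : clim (at_right 0) (fun t => S (phi t z)) d).
  { apply clim_comp with z; [exact LS |]. now apply semigroup_limit. }
  apply (clim_ext (fun t => / S (phi t z))); [| now apply clim_inv].
  generalize (filter_and _ _ at_right_pos (clim_neq _ _ 0 LSphi Hd0)).
  apply filter_imp. intros t [Ht HS].
  pose proof (RtoC_neq_0 t ltac:(lra)) as Ht0.
  assert (E : RtoC t = S (phi t z) * (phi t z - z)).
  { specialize (Hh t (Rlt_le _ _ Ht)). rewrite ES in Hh.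
    replace (S (phi t z) * (phi t z - z)) with (h z + S (phi t z) * (phi t z - z) - h z) by ring.
    rewrite Hh. ring. }
  unfold orbit_slope. rewrite E in Ht0 |- *. field. split; [| exact HS].
  intros E'. apply Ht0. rewrite E'. ring.
Qed.

(** Otherwise the derivative of [h] would vanish on a whole segment of the line and [h] would be
constant there, against injectivity. *)
Lemma regular_point_on_line (h : C -> C) (y : R) :
  univalent h -> (0 <= y <= / 2)%R ->
  exists z d : C, disc z /\ snd z = y /\ C_is_derive h z d /\ d <> 0.
Proof.
  intros [Hh Hinj] Hy. apply NNPP. intros Hno.
  set (p := (0%R, y) : C). set (q := ((/ 4)%R, y) : C).
  assert (Hd : forall x : R, (0 <= x <= / 4)%R -> disc (x, y)).
  { intros x Hx. unfold disc. rewrite <- Cmod_1. apply Cmod_lt_of_sq. simpl. nra. }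
  assert (E : h p = h q).
  { apply constant_on_segment. intros s Hs.
    assert (Es : p + RtoC s * (q - p) = ((s * / 4)%R, y)).
    { unfold p, q, Cplus, Cmult, Cminus, Copp, RtoC. simpl. f_equal; field. }
    rewrite Es. assert (Ds : disc ((s * / 4)%R, y)) by (apply Hd; lra).
    destruct (Hh _ Ds) as [d Hd']. destruct (Ceq_dec d 0) as [<- | Hn]; [exact Hd' |].
    exfalso. apply Hno. exists ((s * / 4)%R, y), d. auto. }
  apply Hinj in E; [| apply Hd; lra | apply Hd; lra].
  apply (f_equal fst) in E. simpl in E. lra.
Qed.

Lemma generator_is_quadratic (phi : R -> C -> C) (G : C -> C) :
  linear_fractional_semigroup phi -> infinitesimal_generator phi G ->
  exists a b c p q r, coefficients phi a b c /\ infinitesimal_coefficients phi a b c p q r /\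
    forall z, disc z -> G z = p + q * z + r * (z * z).
Proof.
  intros Hphi HG. pose proof (proj1 Hphi) as Hs.
  destruct (coefficients_exist phi Hphi) as (a & b & c & H).
  assert (Dp : disc (RtoC (/ 2))) by (apply disc_RtoC, Rabs_def1; lra).
  assert (Dm : disc (RtoC (- / 2))) by (apply disc_RtoC, Rabs_def1; lra).
  destruct (infinitesimal_coefficients_exist phi a b c 0 (RtoC (/ 2)) (RtoC (- / 2))
    (G 0) (G (RtoC (/ 2))) (G (RtoC (- / 2))) Hs H disc_0 Dp Dm) as (p & q & r & Hi);
    try (now apply generator_orbit_slope; auto using disc_0);
    try (intros E; apply RtoC_inj in E; lra).
  exists a, b, c, p, q, r. split; [assumption |]. split; [assumption |].
  intros z Hz. apply (@clim_unique R (at_right 0) _ (orbit_slope phi z)).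
  - now apply generator_orbit_slope.
  - now apply (orbit_slope_limit phi a b c).
Qed.

(** Three points with distinct imaginary parts where the derivative of [h] is nonzero provide the
orbits with a speed; the chain rule at an arbitrary point then shows that the derivative of [h] is
the reciprocal of the generator. *)
Lemma translation_derivative (phi : R -> C -> C) (h : C -> C) :
  linear_fractional_semigroup phi -> univalent h ->
  (forall t z, (0 <= t)%R -> disc z -> h (phi t z) = h z + RtoC t) ->
  exists a b c p q r, coefficients phi a b c /\ infinitesimal_coefficients phi a b c p q r /\
    forall z, disc z -> p + q * z + r * (z * z) <> 0 /\
      C_is_derive h z (/ (p + q * z + r * (z * z))).
Proof.
  intros Hphi Hh Heq. pose proof (proj1 Hphi) as Hs.
  destruct (coefficients_exist phi Hphi) as (a & b & c & H).
  destruct (regular_point_on_line h 0 Hh ltac:(lra)) as (z1 & d1 & D1 & Y1 & H1 & N1).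
  destruct (regular_point_on_line h (/ 4) Hh ltac:(lra)) as (z2 & d2 & D2 & Y2 & H2 & N2).
  destruct (regular_point_on_line h (/ 2) Hh ltac:(lra)) as (z3 & d3 & D3 & Y3 & H3 & N3).
  destruct (infinitesimal_coefficients_exist phi a b c z1 z2 z3 (/ d1) (/ d2) (/ d3)
     Hs H D1 D2 D3) as (p & q & r & Hi);
    try (intros E; rewrite E in *; lra);
    try (apply (slope_inverse phi h); auto).
  exists a, b, c, p, q, r. split; [assumption |]. split; [assumption |].
  intros z Hz. destruct (holomorphic_derive h z (proj1 Hh) Hz) as [d Hd].
  pose proof (slope_chain_rule phi h z d _ Hs Hz Hd
                (orbit_slope_limit phi a b c p q r z H Hi Hz)) as L.
  assert (E : d * (p + q * z + r * (z * z)) = 1).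
  { apply (@clim_unique R (at_right 0) _ _ _ _ L).
    apply (clim_ext (fun _ => 1)); [| apply clim_const].
    generalize at_right_pos. apply filter_imp. intros t Ht.
    rewrite Heq by (assumption || lra). field. apply RtoC_neq_0. lra. }
  assert (Hn : p + q * z + r * (z * z) <> 0).
  { intros E0. apply C1_nz. rewrite <- E, E0. ring. }
  split; [assumption |].
  replace (/ (p + q * z + r * (z * z))) with (d : C); [assumption |].
  rewrite <- (Cmult_1_l (/ _)), <- E. now field.
Qed.

(** * Multipliers at fixed points *)

(** The derivative at [tau] of [z -> (a z + b) / (c z + 1)]. *)
Definition multiplier (a b c tau : C) : C :=
  (a * 1 - b * c) / ((c * tau + 1) * (c * tau + 1)).

Lemma multiplier_at_fixed_point (a b c tau : C) :
  c * tau + 1 <> 0 -> a * tau + b = tau * (c * tau + 1) ->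
  multiplier a b c tau = (a - c * tau) / (c * tau + 1).
Proof.
  intros Hn E. unfold multiplier.
  replace b with (a * tau + b - a * tau) by ring. rewrite E. now field.
Qed.

(** A common fixed point is a root of the generator, and the initial speed of the multipliers is the
derivative of the generator there. *)
Lemma infinitesimal_multiplier (phi : R -> C -> C) (a b c : R -> C) (p q r tau : C) :
  coefficients phi a b c -> infinitesimal_coefficients phi a b c p q r ->
  (Cmod tau <= 1)%R ->
  (forall t, (0 < t)%R -> a t * tau + b t = tau * (c t * tau + 1)) ->
  p + q * tau + r * (tau * tau) = 0 /\
  clim (at_right 0) (fun t => (multiplier (a t) (b t) (c t) tau - 1) / RtoC t) (q + 2 * r * tau).
Proof.
  intros H [Lp Lq Lr Lc] Htau Hfix. split.
  - apply (@clim_unique R (at_right 0) _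
      (fun t => b t / RtoC t + (a t - 1) / RtoC t * tau + - c t / RtoC t * (tau * tau))).
    + repeat apply clim_plus; try assumption; apply clim_mult; try assumption; apply clim_const.
    + apply (clim_ext (fun _ => 0)); [| apply clim_const].
      generalize at_right_pos. apply filter_imp. intros t Ht.
      pose proof (RtoC_neq_0 t ltac:(lra)) as Ht0.
      replace (b t / RtoC t + (a t - 1) / RtoC t * tau + - c t / RtoC t * (tau * tau)) with
        ((a t * tau + b t - tau * (c t * tau + 1)) / RtoC t) by now field.
      rewrite (Hfix t Ht). now field.
  - apply (clim_ext (fun t => ((a t - 1) / RtoC t + 2 * (- c t / RtoC t) * tau) /
      (c t * tau + 1))).
    + generalize at_right_pos. apply filter_imp. intros t Ht.
      pose proof (RtoC_neq_0 t ltac:(lra)) as Ht0.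
      assert (Hn : c t * tau + 1 <> 0)
        by (apply den_neq_0; [apply (coef_c _ _ _ _ H); lra | assumption]).
      rewrite multiplier_at_fixed_point by auto. field. now split.
    + apply (clim_value _ ((q + 2 * r * tau) / (0 * tau + 1))); [field |].
      apply clim_div.
      * apply clim_plus; [exact Lq |]. apply clim_mult; [| apply clim_const].
        apply clim_mult; [apply clim_const | exact Lr].
      * apply clim_plus; [| apply clim_const]. apply clim_mult; [exact Lc | apply clim_const].
      * intros E. apply C1_nz. rewrite <- E. ring.
Qed.

Lemma clim_real_nonpos {T : Type} {F : (T -> Prop) -> Prop} {FF : ProperFilter F}
  (u : T -> C) (l : C) :
  clim F u l -> F (fun t => exists x : R, (x <= 0)%R /\ u t = RtoC x) ->
  exists x : R, (x <= 0)%R /\ l = RtoC x.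
Proof.
  intros Hu Hr. exists (fst l).
  assert (Hm : forall eps : posreal, (Rabs (snd l) < eps)%R /\ (fst l < eps)%R).
  { intros eps.
    destruct (filter_ex _ (filter_and _ _ (proj1 (clim_eps F u l) Hu eps) Hr)) as (t & H & x & Hx & E).
    rewrite E in H. pose proof (Rmax_Cmod (RtoC x - l)) as M. simpl in M.
    pose proof (Rmax_l (Rabs (x + - fst l)) (Rabs (0 + - snd l))).
    pose proof (Rmax_r (Rabs (x + - fst l)) (Rabs (0 + - snd l))).
    rewrite Rplus_0_l, Rabs_Ropp in *. pose proof (Rle_abs (- (x + - fst l))) as Ha.
    rewrite Rabs_Ropp in Ha. lra. }
  split.
  - apply Rnot_lt_le. intros Hp. destruct (Hm (mkposreal _ Hp)) as [_ H]. simpl in H. lra.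
  - assert (Hs : snd l = 0%R).
    { destruct (Req_dec (snd l) 0) as [E | E]; [exact E |]. exfalso.
      destruct (Hm (mkposreal _ (Rabs_pos_lt _ E))) as [H _]. simpl in H. lra. }
    destruct l as [x y]. simpl in *. now rewrite Hs.
Qed.

Lemma quadratic_with_root (p q r tau z : C) :
  p + q * tau + r * (tau * tau) = 0 ->
  p + q * z + r * (z * z) = (z - tau) * ((q + r * tau) + r * z).
Proof.
  intros E. rewrite <- (Cplus_0_r ((z - tau) * _)). rewrite <- E. ring.
Qed.

Lemma sphere_of_inverse (b : C) :
  (Cmod b <= 1)%R -> exists beta, outside_disc beta /\ sphere_inv beta = b.
Proof.
  intros Hb. destruct (Ceq_dec b 0) as [-> | Hn].
  - now exists Infty.
  - exists (Fin (/ b)). simpl. split.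
    + unfold disc. rewrite Cmod_inv by assumption. apply Rle_not_lt.
      rewrite <- Rinv_1. apply Rinv_le_contravar; [now apply Cmod_gt_0 | assumption].
    + now field.
Qed.

Lemma inverse_in_disc (b : C) : ~ (Cmod b <= 1)%R -> b <> 0 /\ disc (/ b).
Proof.
  intros H. assert (Hn : b <> 0) by (apply Cmod_gt_0; lra). split; [assumption |].
  unfold disc. rewrite Cmod_inv by assumption. rewrite <- Rinv_1.
  apply Rinv_lt_contravar; lra.
Qed.

(** [z = tau (1 - 1 / V)] maps the half-plane [Re V > 1 / 2] onto the disc and sends infinity to
[tau], so a self-map fixing [tau] becomes affine in [V]. *)
Lemma cayley_disc (tau V : C) :
  circle tau -> V <> 0 -> disc (tau * (1 - / V)) <-> (/ 2 < fst V)%R.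
Proof.
  intros Ht HV. pose proof (proj1 (Cmod_gt_0 V) HV) as Hm.
  replace (tau * (1 - / V)) with (tau * ((V - 1) / V)) by now field.
  unfold disc. rewrite Cmod_mult, Ht, Rmult_1_l, Cmod_div by assumption.
  assert (E : (Cmod (V - 1) * Cmod (V - 1) = Cmod V * Cmod V - 2 * fst V + 1)%R).
  { rewrite !Cmod_sq. destruct V as [x y]. simpl. ring. }
  pose proof (Cmod_ge_0 (V - 1)) as H0.
  split; intros H.
  - assert (H' : (Cmod (V - 1) < Cmod V)%R).
    { apply (Rmult_lt_compat_r (Cmod V)) in H; [| assumption].
      unfold Rdiv in H. rewrite Rmult_assoc, Rinv_l in H; lra. }
    nra.
  - apply Rmult_lt_reg_r with (Cmod V); [assumption |].
    unfold Rdiv. rewrite Rmult_assoc, Rinv_l by lra. nra.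
Qed.

Lemma cayley_surj (tau z : C) :
  circle tau -> disc z -> exists V : C, V <> 0 /\ z = tau * (1 - / V).
Proof.
  intros Ht Hz. pose proof (circle_neq_0 tau Ht) as Ht0.
  assert (Hn : tau - z <> 0).
  { apply Cminus_eq_contra. intros E. now apply (disc_circle_neq z tau). }
  exists (tau / (tau - z)). split.
  - intros E. apply Ht0. replace tau with (tau / (tau - z) * (tau - z)) by now field.
    rewrite E. ring.
  - field. now split.
Qed.

Lemma neq_0_of_fst (V : C) : fst V <> 0%R -> V <> 0.
Proof. intros H ->. now apply H. Qed.

(** In the coordinate [V] of [cayley_disc] the map is affine, [V -> W + (V - W) / l], where [W]
corresponds to the interior fixed point. If [l < 1], the point at signed distance [- l rho] from
[W], where [rho] is the distance from [W] to the boundary line, is in the half-plane, but its image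
is on that line. If [l = 1], the map is the identity. *)
Lemma interior_and_boundary_fixed_points (a b c tau sigma : C) (l : R) :
  (Cmod c < 1)%R ->
  (forall z, disc z -> disc ((a * z + b) / (c * z + 1))) ->
  disc sigma -> circle tau ->
  a * sigma + b = sigma * (c * sigma + 1) ->
  a * tau + b = tau * (c * tau + 1) ->
  multiplier a b c tau = RtoC l ->
  (1 <= l)%R /\ (l = 1%R -> c = 0 /\ a = 1 /\ b = 0).
Proof.
  intros Hc Hself Hsig Htau Es Et El.
  assert (Ht1 : c * tau + 1 <> 0) by (apply den_neq_0; [assumption | rewrite Htau; lra]).
  assert (Hs1 : c * sigma + 1 <> 0) by (apply den_neq_0; [assumption | unfold disc in Hsig; lra]).
  pose proof (circle_neq_0 tau Htau) as Ht0.
  assert (Hts : tau - sigma <> 0).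
  { apply Cminus_eq_contra. intros E. now apply (disc_circle_neq sigma tau). }
  assert (Ea : a = 1 + c * (sigma + tau)).
  { replace a with ((a * tau + b - (a * sigma + b)) / (tau - sigma)) by now field.
    rewrite Es, Et. now field. }
  assert (Eb : b = - (c * (sigma * tau))).
  { replace b with (a * tau + b - a * tau) by ring. rewrite Et, Ea. ring. }
  rewrite multiplier_at_fixed_point in El by assumption.
  rewrite Ea in El.
  replace (1 + c * (sigma + tau) - c * tau) with (c * sigma + 1) in El by ring.
  assert (El' : c * sigma + 1 = RtoC l * (c * tau + 1)) by (rewrite <- El; now field).
  split.
  - apply Rnot_lt_le. intros Hl.
    assert (Hl0 : RtoC l <> 0).
    { intros E. rewrite E in El'. apply Hs1. rewrite El'. ring. }
    destruct (cayley_surj tau sigma Htau Hsig) as (W & HW & EW).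
    assert (HreW : (/ 2 < fst W)%R)
      by (apply (cayley_disc tau); [assumption | assumption | now rewrite <- EW]).
    (* The preimage [V] of the boundary point [V'] nearest to [W]. *)
    set (rho := (fst W - / 2)%R).
    set (V := W - RtoC (l * rho)). set (V' := W - RtoC rho).
    assert (HV : (/ 2 < fst V)%R) by (unfold V; simpl; unfold rho in *; nra).
    assert (HV' : (fst V' = / 2)%R) by (unfold V'; simpl; unfold rho; ring).
    assert (NV : V <> 0) by (apply neq_0_of_fst; lra).
    assert (NV' : V' <> 0) by (apply neq_0_of_fst; lra).
    assert (Dz : disc (tau * (1 - / V))) by now apply cayley_disc.
    pose proof (Hself _ Dz) as Df.
    replace ((a * (tau * (1 - / V)) + b) / (c * (tau * (1 - / V)) + 1))
      with (tau * (1 - / V')) in Df.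
    + apply cayley_disc in Df; [lra | assumption | assumption].
    + assert (Hzn : c * (tau * (1 - / V)) + 1 <> 0)
        by (apply den_neq_0; [assumption | unfold disc in Dz; lra]).
      assert (E1 : W * (c * sigma + 1) = W * (c * tau + 1) - c * tau)
        by (rewrite EW; now field).
      assert (E2 : (V * (c * tau + 1) - c * tau) - V' * (c * sigma + 1) = 0).
      { replace (V' * (c * sigma + 1)) with (W * (c * sigma + 1) - RtoC rho * (c * sigma + 1))
          by (unfold V'; ring).
        rewrite E1, El'. unfold V. rewrite RtoC_mult. ring. }
      assert (E3 : a * (tau * (1 - / V)) + b - tau * (1 - / V') * (c * (tau * (1 - / V)) + 1) =
        tau / (V * V') * ((V * (c * tau + 1) - c * tau) - V' * (c * sigma + 1))).
      { rewrite Ea, Eb, EW. clear -HW NV NV'. field. repeat split; assumption. }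
      rewrite E2, Cmult_0_r in E3.
      replace (a * (tau * (1 - / V)) + b) with
        (a * (tau * (1 - / V)) + b - tau * (1 - / V') * (c * (tau * (1 - / V)) + 1)
         + tau * (1 - / V') * (c * (tau * (1 - / V)) + 1)) by ring.
      rewrite E3, Cplus_0_l. unfold Cdiv. rewrite <- Cmult_assoc, Cinv_r, Cmult_1_r by assumption.
      reflexivity.
  - intros ->. rewrite Cmult_1_l in El'.
    assert (Ec : c = 0).
    { replace c with ((c * tau + 1 - (c * sigma + 1)) / (tau - sigma)) by now field.
      rewrite El'. now field. }
    split; [exact Ec |]. rewrite Ea, Eb, Ec. split; ring.
Qed.

(** * The logarithm on the right half-plane *)

(** The principal logarithm of a number with positive real part, in a form that is easy to
differentiate along a path. *)
Definition half_plane_log (w : C) : C :=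
  ((ln (fst w * fst w + snd w * snd w) / 2)%R, atan (snd w / fst w)).

Lemma Cexp_half_plane_log (w : C) : (0 < fst w)%R -> Cexp (half_plane_log w) = w.
Proof.
  destruct w as [x y]. simpl. intros Hx.
  set (n := (x * x + y * y)%R). assert (Hn : (0 < n)%R) by (unfold n; nra).
  set (u := (y / x)%R).
  assert (Hu : (0 < 1 + u²)%R) by (pose proof (Rle_0_sqr u); lra).
  assert (Hm : (exp (ln n / 2) = x * sqrt (1 + u²))%R).
  { rewrite <- (sqrt_Rsqr (exp (ln n / 2))) by (left; apply exp_pos).
    rewrite <- (sqrt_Rsqr x) at 1 by lra.
    rewrite <- sqrt_mult by (apply Rle_0_sqr || lra). f_equal.
    unfold Rsqr at 1. rewrite <- exp_plus. replace (ln n / 2 + ln n / 2)%R with (ln n) by field.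
    rewrite exp_ln by assumption. unfold n, u, Rsqr. field. lra. }
  assert (Hs : (0 < sqrt (1 + u²))%R) by now apply sqrt_lt_R0.
  unfold Cexp, half_plane_log, Re, Im. simpl. fold n. fold u.
  rewrite Hm, cos_atan, sin_atan. f_equal; [field; lra |].
  transitivity (x * u)%R; [field; lra | unfold u; field; lra].
Qed.

Lemma Cexp_minus (z w : C) : Cexp (z - w) = Cexp z / Cexp w.
Proof.
  destruct z as [x y], w as [u v].
  assert (Hu := exp_pos u). pose proof (sin2_cos2 v) as Hsc. unfold Rsqr in Hsc.
  unfold Cexp, Cdiv, Cinv, Cmult, Cminus, Cplus, Copp, Re, Im. simpl.
  assert (Hn : (exp u * cos v * (exp u * cos v * 1) + exp u * sin v * (exp u * sin v * 1)
    = exp u * exp u)%R).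
  { transitivity (exp u * exp u * (sin v * sin v + cos v * cos v))%R; [ring |].
    rewrite Hsc. ring. }
  rewrite Hn.
  rewrite exp_plus, exp_Ropp, cos_plus, sin_plus, cos_neg, sin_neg.
  f_equal; field; lra.
Qed.

Lemma cos_eq_1 (x : R) : (- (2 * PI) < x < 2 * PI)%R -> cos x = 1%R -> x = 0%R.
Proof.
  intros Hx Hc. replace x with (2 * (x / 2))%R in Hc by field.
  rewrite cos_2a_sin in Hc. assert (Hs : sin (x / 2) = 0%R) by nra.
  destruct (Rtotal_order x 0) as [H | [H | H]]; [exfalso | exact H | exfalso].
  - pose proof (sin_gt_0 (- (x / 2)) ltac:(lra) ltac:(lra)) as P. rewrite sin_neg in P. lra.
  - pose proof (sin_gt_0 (x / 2) ltac:(lra) ltac:(lra)). lra.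
Qed.

Lemma Cexp_injective_on_strip (z w : C) :
  (- PI < Im z <= PI)%R -> (- PI < Im w <= PI)%R -> Cexp z = Cexp w -> z = w.
Proof.
  destruct z as [x y], w as [u v]. unfold Cexp, Re, Im. simpl. intros Hy Hv E.
  injection E as E1 E2.
  pose proof (exp_pos x) as Hx. pose proof (exp_pos u) as Hu.
  pose proof (sin2_cos2 y) as Sy. pose proof (sin2_cos2 v) as Sv. unfold Rsqr in Sy, Sv.
  assert (Hsq : (exp x * exp x = exp u * exp u)%R).
  { transitivity (exp x * exp x * (sin y * sin y + cos y * cos y))%R; [rewrite Sy; ring |].
    transitivity (exp x * cos y * (exp x * cos y) + exp x * sin y * (exp x * sin y))%R; [ring |].
    rewrite E1, E2.
    transitivity (exp u * exp u * (sin v * sin v + cos v * cos v))%R; [ring | rewrite Sv; ring]. }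
  assert (Hexp : exp x = exp u) by nra.
  apply exp_inv in Hexp as Exu. rewrite Hexp in E1, E2.
  apply Rmult_eq_reg_l in E1; [| lra]. apply Rmult_eq_reg_l in E2; [| lra].
  assert (Hd : (y - v = 0)%R).
  { apply cos_eq_1; [lra |]. rewrite cos_minus, E1, E2. lra. }
  f_equal; [exact Exu | lra].
Qed.

(** Both logarithms have imaginary part in [(- PI / 2, PI / 2)], so their difference lies in the
strip of the principal branch. *)
Lemma Clog_quotient (w1 w2 : C) :
  (0 < fst w1)%R -> (0 < fst w2)%R ->
  Clog (w1 / w2) = half_plane_log w1 - half_plane_log w2.
Proof.
  intros H1 H2.
  assert (N1 : w1 <> 0) by (intros ->; simpl in H1; lra).
  assert (N2 : w2 <> 0) by (intros ->; simpl in H2; lra).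
  assert (Hq : w1 / w2 <> 0).
  { intros E. apply N1. replace w1 with (w1 / w2 * w2) by now field. rewrite E. ring. }
  destruct (Clog_principal _ Hq) as [Hexp Him].
  apply Cexp_injective_on_strip; [exact Him | |].
  - unfold Im. simpl.
    pose proof (atan_bound (snd w1 / fst w1)). pose proof (atan_bound (snd w2 / fst w2)). lra.
  - now rewrite Hexp, Cexp_minus, !Cexp_half_plane_log.
Qed.

Lemma half_plane_one_minus (x : C) (s : R) :
  (Cmod x < 1)%R -> (0 <= s <= 1)%R -> (0 < fst (1 - RtoC s * x)%C)%R.
Proof.
  intros Hx Hs. destruct x as [u v]. simpl.
  pose proof (re_le_Cmod (u, v)) as H. unfold Re in H. simpl in H.
  pose proof (Rle_abs u). destruct (Rle_lt_dec s (/ 2)); nra.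
Qed.

Lemma is_derive_pair (f g : R -> R) (s f' g' : R) :
  is_derive f s f' -> is_derive g s g' ->
  @is_derive R_AbsRing C_R_NormedModule (fun r => (f r, g r) : C) s (f', g').
Proof.
  intros Hf Hg.
  pose proof (@is_derive_plus R_AbsRing C_R_NormedModule _ _ s _ _
    (@is_derive_scal_l R_AbsRing C_R_NormedModule f s f' (1 : C) Hf)
    (@is_derive_scal_l R_AbsRing C_R_NormedModule g s g' (Ci : C) Hg)) as H.
  assert (E : forall x y : R, @plus C_R_NormedModule (scal x (1 : C)) (scal y (Ci : C)) = (x, y)).
  { intros x y. unfold plus, scal, Ci, RtoC. simpl.
    unfold prod_plus, prod_scal, plus, scal, mult. simpl. unfold mult. simpl. f_equal; ring. }
  rewrite E in H. revert H. apply is_derive_ext. intros r. apply E.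
Qed.

(** Only the derivative along a path is needed, so it suffices to differentiate real and imaginary
parts as functions of one real variable. *)
Lemma derive_half_plane_log (x : C) (s : R) :
  (Cmod x < 1)%R -> (0 <= s <= 1)%R ->
  @is_derive R_AbsRing C_R_NormedModule (fun r => half_plane_log (1 - RtoC r * x)) s
    (- x / (1 - RtoC s * x)).
Proof.
  intros Hx Hs. pose proof (half_plane_one_minus x s Hx Hs) as Hp.
  destruct x as [u v]. simpl in Hp. clear Hx Hs.
  assert (Hp' : (0 < 1 - s * u)%R) by lra.
  assert (Hsq : (0 < (1 - s * u) * (1 - s * u) + s * v * (s * v))%R) by nra.
  apply (is_derive_ext (fun r : R =>
    ((ln ((1 - r * u) * (1 - r * u) + r * v * (r * v)) / 2)%R, atan (- (r * v) / (1 - r * u))) : C)).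
  { intros r.
    assert (E : 1 - RtoC r * (u, v) = ((1 - r * u)%R, (- (r * v))%R)).
    { unfold Cminus, Cmult, Cplus, Copp, RtoC. simpl. f_equal; ring. }
    rewrite E. unfold half_plane_log. simpl.
    now replace (- (r * v) * - (r * v))%R with (r * v * (r * v))%R by ring. }
  replace (- (u, v) / (1 - RtoC s * (u, v))) with
    (((- u * (1 - s * u) + v * (s * v)) / ((1 - s * u) * (1 - s * u) + s * v * (s * v)))%R,
     ((- v * (1 - s * u) - u * (s * v)) / ((1 - s * u) * (1 - s * u) + s * v * (s * v)))%R).
  - apply is_derive_pair; auto_derive; try lra; try (repeat split; lra).
    + field. lra.
    + unfold Rsqr. field. repeat split; nra.
  - unfold Cdiv, Cinv, Cminus, Cmult, Cplus, Copp, RtoC. simpl. f_equal; field; nra.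
Qed.

(** * Koenigs functions of elliptic semigroups *)

Lemma boundary_equations (phi : R -> C -> C) (a b c : R -> C) (t : R) (tau l : C) :
  coefficients phi a b c -> (0 < t)%R -> circle tau ->
  boundary_fixed (phi t) tau -> boundary_derivative (phi t) tau l ->
  a t * tau + b t = tau * (c t * tau + 1) /\ multiplier (a t) (b t) (c t) tau = l.
Proof.
  intros H Ht Htau Hfix Hder.
  assert (Hn : c t * tau + 1 <> 0).
  { apply den_neq_0; [apply (coef_c _ _ _ _ H); lra | right; exact Htau]. }
  pose proof (fun z Hz => coef_eq _ _ _ _ H t z (Rlt_le _ _ Ht) Hz) as E.
  split.
  - pose proof (clim_unique _ _ _ (boundary_value_linear_fractional _ _ _ _ _ _ Htau Hn E) Hfix) as Et.
    replace (a t * tau + b t) with ((a t * tau + b t) / (c t * tau + 1) * (c t * tau + 1)) by now field.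
    now rewrite Et.
  - exact (clim_unique _ _ _ (boundary_derivative_linear_fractional _ _ _ _ _ _ Htau Hn E) Hder).
Qed.

Lemma interior_fixed_equation (phi : R -> C -> C) (a b c : R -> C) (t : R) (tau : C) :
  coefficients phi a b c -> (0 <= t)%R -> disc tau -> phi t tau = tau ->
  c t * tau + 1 <> 0 /\ a t * tau + b t = tau * (c t * tau + 1).
Proof.
  intros H Ht Htau E.
  assert (Hn : c t * tau + 1 <> 0).
  { apply den_neq_0; [now apply (coef_c _ _ _ _ H) | unfold disc in Htau; lra]. }
  split; [exact Hn |].
  rewrite (coef_eq _ _ _ _ H) in E by assumption.
  replace (a t * tau + b t) with ((a t * tau + b t) / (c t * tau + 1) * (c t * tau + 1)) by now field.
  now rewrite E.
Qed.

Lemma interior_multiplier (phi : R -> C -> C) (a b c : R -> C) (t : R) (tau : C) :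
  coefficients phi a b c -> (0 <= t)%R -> disc tau ->
  C_derive (phi t) tau = multiplier (a t) (b t) (c t) tau.
Proof.
  intros H Ht Htau. apply is_C_derive_unique.
  apply (derive_ext_disc (fun w => (a t * w + b t) / (c t * w + 1))); [assumption | |].
  - intros w Hw. symmetry. now apply (coef_eq _ _ _ _ H).
  - apply derive_linear_fractional. apply den_neq_0; [now apply (coef_c _ _ _ _ H) |].
    unfold disc in Htau. lra.
Qed.

(** The hyperbolic and parabolic alternatives put [tau] on the unit circle. *)
Lemma denjoy_wolff_interior (phi : R -> C -> C) (tau : C) :
  denjoy_wolff_point phi tau -> disc tau -> elliptic_at phi tau.
Proof.
  intros [_ [H | [[H _] | [H _]]]] Ht; [exact H | |]; unfold disc, circle in *; lra.
Qed.

(** This separates the types: a semigroup with an interior fixed point cannot be hyperbolic, and it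
can be parabolic only if it is trivial. *)
Lemma elliptic_boundary_multiplier (phi : R -> C -> C) (sigma tau : C) (t l : R) :
  linear_fractional_semigroup phi -> (0 < t)%R ->
  elliptic_at phi sigma -> circle tau ->
  boundary_fixed (phi t) tau -> boundary_derivative (phi t) tau (RtoC l) ->
  (1 <= l)%R /\ (l = 1%R -> forall z, disc z -> phi t z = z).
Proof.
  intros Hphi Ht [Hsig Hfix] Htau Hb Hd.
  destruct (coefficients_exist phi Hphi) as (a & b & c & H).
  destruct (boundary_equations phi a b c t tau (RtoC l) H Ht Htau Hb Hd) as [Et El].
  destruct (interior_fixed_equation phi a b c t sigma H (Rlt_le _ _ Ht) Hsig (Hfix t Ht)) as [_ Es].
  pose proof (coef_c _ _ _ _ H t (Rlt_le _ _ Ht)) as Hc.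
  destruct (interior_and_boundary_fixed_points (a t) (b t) (c t) tau sigma l) as [H1 H2];
    try assumption.
  - intros z Hz. rewrite <- (coef_eq _ _ _ _ H) by (assumption || lra).
    apply (proj1 (proj1 Hphi) t); [lra | assumption].
  - split; [exact H1 |]. intros E z Hz. destruct (H2 E) as (Ec & Ea & Eb).
    rewrite (coef_eq _ _ _ _ H), Ea, Eb, Ec by (assumption || lra). field.
Qed.

(** The equation is [h' (z - tau) (1 - k z) = (1 - k tau) h]. Equivalently, [h (1 - k z) / (z -
tau)] has zero derivative away from [tau]; its value is found by letting the point tend to [tau]
along a segment, where [h' tau = 1]. *)
Lemma elliptic_koenigs (phi : R -> C -> C) (h : C -> C) :
  linear_fractional_semigroup phi -> elliptic phi -> koenigs_function phi h ->
  exists (tau : C) (beta : sphere), disc tau /\ outside_disc beta /\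
    forall z, disc z -> h z = (1 - sphere_inv beta * tau) *
              ((z - tau) / (1 - sphere_inv beta * z)).
Proof.
  intros Hphi [Hnt (tau0 & Htau0 & Hfix0)] [Huni (tau & HDW & [Hint | Hbd])].
  2: { exfalso. destruct Hbd as (_ & _ & Heq).
       pose proof (Heq 1%R tau0 ltac:(lra) Htau0) as E.
       rewrite Hfix0 in E by lra. apply C1_nz.
       replace (1 : C) with (h tau0 + 1 - h tau0) by ring. rewrite <- E. ring. }
  destruct Hint as (Htau & h0 & h1 & G & HG & Heq).
  pose proof (denjoy_wolff_interior phi tau HDW Htau) as [_ Hfix].
  destruct (generator_is_quadratic phi G Hphi HG) as (a & b & c & p & q & r & H & Hi & EG).
  destruct (infinitesimal_multiplier phi a b c p q r tau H Hi) as [Hroot Hmult].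
  { unfold disc in Htau. lra. }
  { intros t Ht. now apply (interior_fixed_equation phi a b c t tau H (Rlt_le _ _ Ht) Htau), Hfix. }
  set (lambda := q + 2 * r * tau) in *. set (A := q + r * tau).
  assert (Hquad : forall z, p + q * z + r * (z * z) = (z - tau) * (A + r * z))
    by (intros z; now apply quadratic_with_root).
  assert (EGtau : C_derive G tau = lambda).
  { apply is_C_derive_unique.
    apply (derive_ext_disc (fun w => p + q * w + r * (w * w))); [assumption | |].
    - intros w Hw. symmetry. now apply EG.
    - apply derive_quadratic. }
  assert (Hlam : lambda <> 0).
  { intros E. apply Hnt. intros t z Ht Hz.
    apply Huni; [now apply (proj1 (proj1 Hphi) t) | assumption |].
    destruct (Heq t z Ht Hz) as [E1 E2]. rewrite E1, E2, EGtau, E, Cmult_0_l.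
    rewrite Cexp_RtoC, exp_0. ring. }
  assert (Hode : forall z d, disc z -> C_is_derive h z d ->
    d * ((z - tau) * (A + r * z)) = lambda * h z).
  { intros z d Hz Hd. rewrite <- Hquad.
    apply (@clim_unique R (at_right 0) _ (fun t => (h (phi t z) - h z) / RtoC t)).
    - apply (slope_chain_rule phi h z d); [apply Hphi | assumption | assumption |].
      now apply (orbit_slope_limit phi a b c).
    - apply (clim_ext (fun t => (multiplier (a t) (b t) (c t) tau - 1) / RtoC t * h z)).
      + generalize at_right_pos. apply filter_imp. intros t Ht.
        rewrite (proj1 (Heq t z (Rlt_le _ _ Ht) Hz)).
        rewrite (interior_multiplier phi a b c) by (assumption || lra).
        unfold Cdiv. ring.
      + apply clim_mult; [exact Hmult | apply clim_const]. }
  assert (Hzero : forall w, disc w -> A + r * w = 0 -> w = tau).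
  { intros w Hw E. destruct (holomorphic_derive h w (proj1 Huni) Hw) as [d Hd].
    pose proof (Hode w d Hw Hd) as O. rewrite E, !Cmult_0_r in O.
    apply Huni; [assumption | assumption |]. rewrite h0.
    replace (h w) with (/ lambda * (lambda * h w)) by (now field). rewrite <- O. ring. }
  (* The factor [A + r z] has no root in the disc: it could only be [tau], where its value is
  [lambda]. *)
  assert (HlA : lambda = A + r * tau) by (unfold lambda, A; ring).
  assert (HA : A <> 0).
  { intros E. apply Hlam. rewrite HlA, E.
    rewrite <- (Hzero 0 disc_0); [ring | rewrite E; ring]. }
  set (k := - (r / A)).
  assert (HAk : forall z, A + r * z = A * (1 - k * z)) by (intros z; unfold k; now field).
  rewrite HAk in HlA.
  assert (Hu : 1 - k * tau <> 0).
  { intros E. apply Hlam. rewrite HlA, E. ring. }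
  assert (Hk : (Cmod k <= 1)%R).
  { apply NNPP. intros Hk. destruct (inverse_in_disc k Hk) as [Hk0 Hkd].
    apply Hu. rewrite <- (Hzero (/ k) Hkd); [now field |]. rewrite HAk. now field. }
  destruct (sphere_of_inverse k Hk) as (beta & Hbeta & Ebeta).
  exists tau, beta. split; [assumption |]. split; [assumption |]. rewrite Ebeta.
  intros z Hz.
  destruct (Ceq_dec z tau) as [-> | Hzt]; [rewrite h0; now field |].
  set (K := fun w => h w * (1 - k * w) / (w - tau)).
  assert (HK : forall w, disc w -> w <> tau -> C_is_derive K w (RtoC 0)).
  { intros w Hw Hwt. apply Cminus_eq_contra in Hwt.
    destruct (holomorphic_derive h w (proj1 Huni) Hw) as [d Hd].
    pose proof (Hode w d Hw Hd) as O. rewrite HAk, HlA in O.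
    assert (O' : d * (1 - k * w) * (w - tau) - h w * (1 - k * tau) = 0).
    { replace (d * (1 - k * w) * (w - tau)) with (/ A * (d * ((w - tau) * (A * (1 - k * w)))))
        by now field.
      rewrite O. now field. }
    apply caratheodory in Hd. destruct Hd as (S & LS & ES).
    assert (LD : clim (@locally C_UniformSpace w) (fun x => x - tau) (w - tau)).
    { apply clim_minus; [apply clim_id | apply clim_const]. }
    apply (derive_of_slope K (fun x => (S x * (1 - k * x) * (w - tau) - h w * (1 - k * tau)) /
              ((x - tau) * (w - tau)))).
    - generalize (clim_neq _ _ 0 LD Hwt). apply filter_imp. intros x Hx.
      unfold K. rewrite (ES x). field. now split.
    - apply (clim_value _ ((d * (1 - k * w) * (w - tau) - h w * (1 - k * tau)) /
              ((w - tau) * (w - tau)))); [rewrite O'; now field |].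
      apply clim_div; [| | now apply Cmult_neq_0].
      + apply clim_minus; [| apply clim_const]. apply clim_mult; [| apply clim_const].
        apply clim_mult; [exact LS |]. apply clim_minus; [apply clim_const |].
        apply clim_mult; [apply clim_const | apply clim_id].
      + apply clim_mult; [exact LD | apply clim_const]. }
  pose proof (one_minus_mult_neq_0 k z Hk Hz) as Hkz.
  assert (Hzt' := Cminus_eq_contra _ _ Hzt).
  cut (K z = 1 - k * tau).
  { intros E. replace (h z) with (K z * ((z - tau) / (1 - k * z)))
      by (unfold K; field; now split). now rewrite E. }
  destruct (holomorphic_derive h tau (proj1 Huni) Htau) as [d Hd].
  assert (Ed : d = 1) by (rewrite <- h1; symmetry; now apply is_C_derive_unique).
  rewrite Ed in Hd. apply caratheodory in Hd. destruct Hd as (S & LS & ES).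
  set (w := fun s : R => tau + RtoC s * (z - tau)).
  assert (Lw : clim (at_right 0) w tau).
  { apply (clim_value _ (tau + 0 * (z - tau))); [ring |].
    apply clim_plus; [apply clim_const |]. apply clim_mult; [| apply clim_const].
    apply clim_RtoC. intros P HP. now apply filter_le_within. }
  apply (@clim_unique R (at_right 0) _ (fun s => S (w s) * (1 - k * w s))).
  - apply (clim_ext (fun _ => K z)); [| apply clim_const].
    assert (Hlt1 : at_right 0 (fun s => (s < 1)%R)).
    { apply filter_le_within. now apply open_lt, Rlt_0_1. }
    generalize (filter_and _ _ at_right_pos Hlt1). apply filter_imp. intros s [Hs0 Hs1].
    assert (Hws : w s - tau = RtoC s * (z - tau)) by (unfold w; ring).
    assert (Hs0' := RtoC_neq_0 s ltac:(lra)).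
    transitivity (K (w s)).
    + symmetry. apply constant_on_segment. intros x Hx.
      assert (Ex : w s + RtoC x * (z - w s) = tau + RtoC (s + x * (1 - s)) * (z - tau)).
      { unfold w. rewrite RtoC_plus, RtoC_mult, RtoC_minus. ring. }
      assert (Hx' : (0 < s + x * (1 - s) <= 1)%R) by nra.
      rewrite Ex. apply HK.
      * apply disc_convex; [assumption | assumption | lra].
      * intros E. apply (Cmult_neq_0 (RtoC (s + x * (1 - s))) (z - tau));
          [apply RtoC_neq_0; lra | assumption |].
        replace (RtoC (s + x * (1 - s)) * (z - tau)) with
          (tau + RtoC (s + x * (1 - s)) * (z - tau) - tau) by ring.
        rewrite E. ring.
    + unfold K. rewrite (ES (w s)), h0, Hws. field. now split.
  - apply (clim_value _ (1 * (1 - k * tau))); [ring |].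
    apply clim_mult; [apply clim_comp with tau; assumption |].
    apply clim_minus; [apply clim_const |]. apply clim_mult; [apply clim_const | exact Lw].
Qed.

(** * Koenigs functions of hyperbolic and parabolic semigroups *)

(** The predicate [P] on the multipliers lets the hyperbolic and the parabolic cases share this
computation. The path [u] of mean speeds of the multipliers is returned because its limit, the
derivative of the generator at [tau], is what distinguishes the two cases. *)
Lemma boundary_koenigs_derivative (phi : R -> C -> C) (h : C -> C) (tau : C)
  (P : R -> Prop) :
  linear_fractional_semigroup phi -> univalent h ->
  (forall t z, (0 <= t)%R -> disc z -> h (phi t z) = h z + RtoC t) ->
  circle tau ->
  (forall t, (0 < t)%R -> boundary_fixed (phi t) tau /\
     exists l : R, P l /\ boundary_derivative (phi t) tau (RtoC l)) ->
  exists A k : C, A <> 0 /\ (Cmod k <= 1)%R /\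
    (forall z, disc z -> C_is_derive h z (/ (A * (z - tau) * (1 - k * z)))) /\
    exists u : R -> C, clim (at_right 0) u (A * (1 - k * tau)) /\
      at_right 0 (fun t => exists l : R, P l /\ u t = RtoC ((l - 1) / t)).
Proof.
  intros Hphi Hh Heq Htau Hb.
  destruct (translation_derivative phi h Hphi Hh Heq) as (a & b & c & p & q & r & H & Hi & Hd).
  destruct (infinitesimal_multiplier phi a b c p q r tau H Hi) as [Hroot Hmult].
  { right. exact Htau. }
  { intros t Ht. destruct (Hb t Ht) as [Hfix (l & _ & Hder)].
    now apply (boundary_equations phi a b c t tau (RtoC l)). }
  pose proof (circle_neq_0 tau Htau) as Ht0.
  set (A := q + r * tau).
  assert (HA : A <> 0).
  { intros E. apply (proj1 (Hd 0 disc_0)). rewrite (quadratic_with_root p q r tau) by assumption.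
    fold A. rewrite E. ring. }
  set (k := - (r / A)).
  assert (Hquad : forall z, p + q * z + r * (z * z) = A * (z - tau) * (1 - k * z)).
  { intros z. rewrite (quadratic_with_root p q r tau) by assumption. fold A. unfold k. now field. }
  exists A, k. split; [exact HA |]. split; [| split].
  - apply NNPP. intros Hk. destruct (inverse_in_disc k Hk) as [Hk0 Hkd].
    apply (proj1 (Hd _ Hkd)). rewrite Hquad. now field.
  - intros z Hz. rewrite <- Hquad. now apply Hd.
  - exists (fun t => (multiplier (a t) (b t) (c t) tau - 1) / RtoC t). split.
    + apply (clim_value _ (q + 2 * r * tau)); [| exact Hmult].
      unfold k. replace (A * (1 - - (r / A) * tau)) with (A + r * tau) by now field.
      unfold A. ring.
    + generalize at_right_pos. apply filter_imp. intros t Ht.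
      destruct (Hb t Ht) as [Hfix (l & Hl & Hder)]. exists l. split; [exact Hl |].
      rewrite (proj2 (boundary_equations phi a b c t tau (RtoC l) H Ht Htau Hfix Hder)).
      rewrite RtoC_div, RtoC_minus by lra. reflexivity.
Qed.

Lemma parabolic_koenigs_formula (h : C -> C) (A k tau : C) :
  circle tau -> A <> 0 -> h 0 = 0 -> 1 - k * tau = 0 ->
  (forall z, disc z -> C_is_derive h z (/ (A * (z - tau) * (1 - k * z)))) ->
  forall z, disc z -> h z = / A * (z / (z - tau)).
Proof.
  intros Htau HA h0 Hk Hd.
  pose proof (circle_neq_0 tau Htau) as Ht0.
  assert (Ek : k = / tau).
  { replace k with ((1 - (1 - k * tau)) / tau) by now field. rewrite Hk. now field. }
  apply (equal_of_derive _ _ (fun z => / (A * (z - tau) * (1 - k * z))) Hd).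
  - intros z Hz. pose proof (Cminus_eq_contra _ _ (disc_circle_neq z tau Hz Htau)) as Hzt.
    assert (D := derive_linear_fractional (/ A) 0 1 (- tau) z).
    replace (1 * z + - tau) with (z - tau) in D by ring.
    specialize (D Hzt).
    replace ((/ A * - tau - 0 * 1) / ((z - tau) * (z - tau))) with
      (/ (A * (z - tau) * (1 - k * z))) in D.
    + apply (derive_ext_disc (fun w : C => (/ A * w + 0) / (1 * w + - tau))); [exact Hz | | exact D].
      intros w _. unfold Cdiv. replace (1 * w + - tau) with (w - tau) by ring. ring.
    + rewrite Ek. field. repeat split; try assumption.
      intros E. apply Hzt. replace (z - tau) with (- (tau - z)) by ring. rewrite E. ring.
  - rewrite h0. unfold Cdiv. ring.
Qed.

(** In the coordinate [tau / (z - tau)], the time [t] map is the translation by [t A]. *)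
Lemma parabolic_orbit (phi : R -> C -> C) (h : C -> C) (A tau : C) (t : R) :
  circle tau -> A <> 0 -> (forall z, disc z -> disc (phi t z)) ->
  (forall z, disc z -> h z = / A * (z / (z - tau))) ->
  (forall z, disc z -> h (phi t z) = h z + RtoC t) ->
  forall z, disc z -> phi t z - tau <> 0 /\ z - tau <> 0 /\
    tau / (phi t z - tau) = tau / (z - tau) + RtoC t * A.
Proof.
  intros Htau HA Hself Hh Heq z Hz.
  pose proof (Cminus_eq_contra _ _ (disc_circle_neq z tau Hz Htau)) as Hzt.
  pose proof (Cminus_eq_contra _ _ (disc_circle_neq _ tau (Hself z Hz) Htau)) as Hft.
  split; [exact Hft |]. split; [exact Hzt |].
  pose proof (Heq z Hz) as E. rewrite !Hh in E by auto.
  replace (tau / (phi t z - tau)) with (A * (/ A * (phi t z / (phi t z - tau))) - 1)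
    by (field; split; assumption).
  rewrite E. field. split; assumption.
Qed.

Lemma parabolic_orbit_moebius (phi : R -> C -> C) (h : C -> C) (A tau : C) (t : R) :
  circle tau -> A <> 0 -> (forall z, disc z -> disc (phi t z)) ->
  (forall z, disc z -> h z = / A * (z / (z - tau))) ->
  (forall z, disc z -> h (phi t z) = h z + RtoC t) ->
  forall z, disc z -> phi t z = moebius tau (/ tau) (- (RtoC t * A)) z.
Proof.
  intros Htau HA Hself Hh Heq z Hz.
  destruct (parabolic_orbit phi h A tau t Htau HA Hself Hh Heq z Hz) as (Hft & Hzt & E).
  pose proof (circle_neq_0 tau Htau) as Ht0.
  assert (E' : 1 - - (RtoC t * A) * / tau * (z - tau) = (z - tau) / (phi t z - tau)).
  { replace (1 - - (RtoC t * A) * / tau * (z - tau)) with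
      ((tau / (z - tau) + RtoC t * A) * ((z - tau) / tau)) by (field; now split).
    rewrite <- E. field. now split. }
  assert (Hn : 1 - - (RtoC t * A) * / tau * (z - tau) <> 0).
  { rewrite E'. intros E0. apply Hzt.
    replace (z - tau) with ((z - tau) / (phi t z - tau) * (phi t z - tau)) by now field.
    rewrite E0. ring. }
  pose proof (moebius_minus_tau tau (/ tau) _ z Hn) as M. rewrite E' in M.
  replace (moebius tau (/ tau) (- (RtoC t * A)) z) with
    (moebius tau (/ tau) (- (RtoC t * A)) z - tau + tau) by ring.
  rewrite M. field. repeat split; assumption.
Qed.

(** By partial fractions, [1 / (A (z - tau) (1 - k z))] is [1 / (A (1 - k tau))] times the
difference of the logarithmic derivatives of [1 - Cconj tau z] and [1 - k z], both of which have
positive real part on the disc. *)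
Lemma hyperbolic_koenigs_formula (h : C -> C) (A k tau : C) (x : R) :
  circle tau -> A <> 0 -> (Cmod k <= 1)%R -> h 0 = 0 ->
  A * (1 - k * tau) = RtoC x -> x <> 0%R ->
  (forall z, disc z -> C_is_derive h z (/ (A * (z - tau) * (1 - k * z)))) ->
  forall z, disc z -> h z = RtoC (/ x) * Clog ((1 - Cconj tau * z) / (1 - k * z)).
Proof.
  intros Htau HA Hk h0 Hx Hx0 Hd z Hz.
  pose proof (circle_conj tau Htau) as Hc.
  assert (H1 : (Cmod (Cconj tau * z) < 1)%R).
  { apply Cmod_mult_lt_1; [| assumption]. rewrite Cmod_conj. right. exact Htau. }
  assert (H2 : (Cmod (k * z) < 1)%R) by now apply Cmod_mult_lt_1.
  (* Along the radius to [z], the difference of both sides is constant. *)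
  set (F := fun s : R => h (0 + RtoC s * z) -
    RtoC (/ x) * (half_plane_log (1 - RtoC s * (Cconj tau * z)) -
                  half_plane_log (1 - RtoC s * (k * z)))).
  assert (EF : F 0%R = F 1%R).
  { apply (@eq_is_derive C_R_NormedModule F); [| lra]. intros s Hs.
    assert (Ds : disc (0 + RtoC s * z)).
    { replace (0 + RtoC s * z) with (0 + RtoC s * (z - 0)) by ring.
      apply disc_convex; [apply disc_0 | assumption | assumption]. }
    pose proof (derive_along_path h 0 z _ s (Hd _ Ds)) as Dh.
    pose proof (derive_half_plane_log (Cconj tau * z) s H1 Hs) as Dl1.
    pose proof (derive_half_plane_log (k * z) s H2 Hs) as Dl2.
    pose proof (@is_derive_minus R_AbsRing C_R_NormedModule _ _ s _ _ Dl1 Dl2) as Dl.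
    pose proof (path_derive_scal _ (/ x) s _ Dl) as Dls.
    pose proof (@is_derive_minus R_AbsRing C_R_NormedModule _ _ s _ _ Dh Dls) as D.
    refine (eq_ind _ (fun d => is_derive F s d) D _ _).
    {
      pose proof (one_minus_mult_neq_0 k _ Hk Ds) as N2.
      pose proof (Cminus_eq_contra _ _ (disc_circle_neq _ _ Ds Htau)) as N3.
      replace (0 + RtoC s * z) with (RtoC s * z) in * by ring.
      assert (Ek : k * (RtoC s * z) = RtoC s * (k * z)) by ring. rewrite Ek in *.
      assert (Et : 1 - RtoC s * (Cconj tau * z) = - Cconj tau * (RtoC s * z - tau)).
      { rewrite <- Hc. ring. }
      rewrite Et.
      assert (Nc : Cconj tau <> 0).
      { intros E. apply C1_nz. rewrite <- Hc, E. ring. }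
      assert (Nu : 1 - k * tau <> 0).
      { intros E. apply Hx0. apply RtoC_inj. rewrite <- Hx, E. ring. }
      rewrite RtoC_inv, <- Hx by assumption.
      change (/ (A * (RtoC s * z - tau) * (1 - RtoC s * (k * z))) * z -
        / (A * (1 - k * tau)) * (- (Cconj tau * z) / (- Cconj tau * (RtoC s * z - tau)) -
          - (k * z) / (1 - RtoC s * (k * z))) = 0).
      field. repeat split; assumption. } }
  unfold F in EF.
  replace (0 + RtoC 0 * z) with (0 : C) in EF by ring.
  replace (0 + RtoC 1 * z) with z in EF by ring.
  rewrite h0, !Cmult_0_l, !Cmult_1_l in EF.
  rewrite Clog_quotient.
  - set (L := half_plane_log (1 - Cconj tau * z) - half_plane_log (1 - k * z)) in *.
    replace (h z) with (h z - RtoC (/ x) * L + RtoC (/ x) * L) by ring. rewrite <- EF. ring.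
  - rewrite <- (Cmult_1_l (Cconj tau * z)). now apply half_plane_one_minus; [| lra].
  - rewrite <- (Cmult_1_l (k * z)). now apply half_plane_one_minus; [| lra].
Qed.

(** An interior point in the definition of the Koenigs function would be an interior fixed point,
which the boundary data exclude. *)
Lemma boundary_functional_equation (phi : R -> C -> C) (h : C -> C) (tau : C) :
  linear_fractional_semigroup phi -> koenigs_function phi h -> circle tau ->
  ~ trivial_semigroup phi ->
  (exists l : R, (l < 1)%R /\ boundary_fixed (phi 1%R) tau /\
     boundary_derivative (phi 1%R) tau (RtoC l)) \/
  (forall t, (0 < t)%R -> boundary_fixed (phi t) tau /\ boundary_derivative (phi t) tau 1) ->
  univalent h /\ h 0 = 0 /\
  forall t z, (0 <= t)%R -> disc z -> h (phi t z) = h z + RtoC t.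
Proof.
  intros Hphi [Huni (sigma & HDW & [Hint | Hbd])] Htau Hnt Hb.
  2: { split; [exact Huni | exact (proj2 Hbd)]. }
  exfalso. destruct Hint as (Hsig & _).
  pose proof (denjoy_wolff_interior phi sigma HDW Hsig) as Hell.
  destruct Hb as [(l & Hl & Hfix & Hder) | Hpar].
  - destruct (elliptic_boundary_multiplier phi sigma tau 1 l Hphi Rlt_0_1 Hell Htau Hfix Hder). lra.
  - apply Hnt. intros t z Ht Hz. destruct Ht as [Ht | <-].
    + destruct (Hpar t Ht) as [Hfix Hder].
      destruct (elliptic_boundary_multiplier phi sigma tau t 1 Hphi Ht Hell Htau Hfix Hder). auto.
    + now apply (proj1 Hphi).
Qed.

(** The derivative [x] of the generator at [tau] is a limit of negative numbers, hence only known to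
be nonpositive. If it vanished, [h] would be of the parabolic form, and the semigroup would have
multiplier [1] at [tau]. *)
Lemma hyperbolic_koenigs (phi : R -> C -> C) (h : C -> C) :
  linear_fractional_semigroup phi -> hyperbolic phi -> koenigs_function phi h ->
  exists alpha : R, (alpha < 0)%R /\
    exists (tau : C) (beta : sphere),
      circle tau /\ outside_disc beta /\ beta <> Fin tau /\
      forall z, disc z ->
        h z = RtoC alpha * Clog ((1 - Cconj tau * z) / (1 - sphere_inv beta * z)).
Proof.
  intros Hphi [Hnt (tau & Htau & Hhyp)] HK.
  destruct (boundary_functional_equation phi h tau Hphi HK Htau Hnt) as (Huni & h0 & Heq).
  { left. destruct (Hhyp 1%R Rlt_0_1) as [Hfix (l & Hl & Hder)]. now exists l. }
  destruct (boundary_koenigs_derivative phi h tau (fun l => (l < 1)%R) Hphi Huni Heq Htau Hhyp)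
    as (A & k & HA & Hk & Hd & u & Lu & Hu).
  destruct (clim_real_nonpos u _ Lu) as (x & Hx & Ex).
  { generalize (filter_and _ _ at_right_pos Hu). apply filter_imp.
    intros t [Ht (l & Hl & E)]. exists ((l - 1) / t)%R. split; [| exact E].
    apply Rmult_le_reg_r with t; [assumption |].
    unfold Rdiv. rewrite Rmult_assoc, Rinv_l; lra. }
  assert (Hself : forall z, disc z -> disc (phi 1%R z)).
  { apply (proj1 (proj1 Hphi) 1%R). lra. }
  assert (Hx0 : x <> 0%R).
  { intros E. rewrite E in Ex.
    assert (Hkt : 1 - k * tau = 0).
    { replace (1 - k * tau) with (/ A * (A * (1 - k * tau))) by now field. rewrite Ex. ring. }
    pose proof (parabolic_koenigs_formula h A k tau Htau HA h0 Hkt Hd) as Hform.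
    destruct (moebius_boundary (phi 1%R) tau (/ tau) (- (RtoC 1 * A)) Htau) as [_ D1].
    { apply (parabolic_orbit_moebius phi h A tau 1 Htau HA Hself Hform).
      intros z Hz. apply Heq; [lra | assumption]. }
    destruct (Hhyp 1%R Rlt_0_1) as [_ (l & Hl & Hder)].
    pose proof (clim_unique _ _ _ D1 Hder) as El.
    pose proof (circle_neq_0 tau Htau) as Ht0.
    replace (1 - - (RtoC 1 * A) * (1 - / tau * tau)) with (RtoC 1) in El by now field.
    apply RtoC_inj in El. lra. }
  assert (Hneg : (x < 0)%R) by lra.
  destruct (sphere_of_inverse k Hk) as (beta & Hbeta & Ebeta).
  exists (/ x)%R. split; [now apply Rinv_lt_0_compat |].
  exists tau, beta. split; [assumption |]. split; [assumption |]. split.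
  - intros E. rewrite E in Ebeta. simpl in Ebeta. apply Hx0, RtoC_inj.
    pose proof (circle_neq_0 tau Htau) as Ht0.
    rewrite <- Ex, <- Ebeta. now field.
  - rewrite Ebeta. now apply (hyperbolic_koenigs_formula h A k tau x).
Qed.

(** The sign condition on [alpha = 1 / A] comes from the invariance of the disc: in the coordinate
of [cayley_disc] the time one map is [V -> V - A], which must preserve a right half-plane. *)
Lemma parabolic_koenigs (phi : R -> C -> C) (h : C -> C) :
  linear_fractional_semigroup phi -> parabolic phi -> koenigs_function phi h ->
  exists alpha : C, alpha <> 0 /\ (Re alpha <= 0)%R /\
    exists tau : C, circle tau /\ forall z, disc z -> h z = alpha * (z / (z - tau)).
Proof.
  intros Hphi [Hnt (tau & Htau & Hpar)] HK.
  destruct (boundary_functional_equation phi h tau Hphi HK Htau Hnt) as (Huni & h0 & Heq).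
  { now right. }
  destruct (boundary_koenigs_derivative phi h tau (fun l => l = 1%R) Hphi Huni Heq Htau)
    as (A & k & HA & Hk & Hd & u & Lu & Hu).
  { intros t Ht. destruct (Hpar t Ht) as [Hfix Hder]. split; [exact Hfix |]. now exists 1%R. }
  assert (Hkt : 1 - k * tau = 0).
  { assert (E : A * (1 - k * tau) = 0).
    { apply (clim_unique u _ _ Lu). apply (clim_ext (fun _ => 0)); [| apply clim_const].
      revert Hu. apply filter_imp. intros t (l & -> & ->). f_equal. unfold Rdiv. ring. }
    replace (1 - k * tau) with (/ A * (A * (1 - k * tau))) by now field. rewrite E. ring. }
  pose proof (parabolic_koenigs_formula h A k tau Htau HA h0 Hkt Hd) as Hform.
  assert (Hself : forall z, disc z -> disc (phi 1%R z)).
  { apply (proj1 (proj1 Hphi) 1%R). lra. }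
  pose proof (circle_neq_0 tau Htau) as Ht0.
  assert (HreA : (fst A <= 0)%R).
  { apply Rnot_lt_le. intros Hpos.
    (* A point at distance [Re A / 2] from the boundary line, which the translation pushes across
    it. *)
    set (V := ((/ 2 + fst A / 2)%R, 0%R) : C).
    assert (HV : (/ 2 < fst V)%R) by (simpl; lra).
    assert (NV : V <> 0) by (apply neq_0_of_fst; lra).
    assert (Dz : disc (tau * (1 - / V))) by now apply cayley_disc.
    destruct (parabolic_orbit phi h A tau 1 Htau HA Hself Hform
      (fun z Hz => Heq 1%R z (Rlt_le _ _ Rlt_0_1) Hz) _ Dz) as (Hft & Hzt & E).
    destruct (cayley_surj tau _ Htau (Hself _ Dz)) as (V' & NV' & EV').
    assert (HV' : (/ 2 < fst V')%R).
    { apply (cayley_disc tau); [assumption | assumption |]. rewrite <- EV'. now apply Hself. }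
    rewrite EV' in E.
    assert (Ez : forall W : C, W <> 0 -> tau / (tau * (1 - / W) - tau) = - W).
    { intros W HW. replace (tau * (1 - / W) - tau) with (- (tau / W)) by now field.
      field. now split. }
    rewrite !Ez, Cmult_1_l in E by assumption.
    apply (f_equal fst) in E. simpl in E, HV. lra. }
  exists (/ A). split.
  { intros E. apply C1_nz. rewrite <- (Cinv_r _ HA), E. ring. }
  split.
  { destruct A as [x y]. simpl in *. apply sq_pos_of_neq_0 in HA. simpl in HA.
    unfold Rdiv. apply Ropp_le_cancel. rewrite Ropp_0, Ropp_mult_distr_l.
    apply Rmult_le_pos; [lra |]. left. apply Rinv_0_lt_compat. lra. }
  exists tau. now split.
Qed.

Theorem proposition2p8 (h : C -> C) (h_holo : holomorphic h) :
  ((exists phi : R -> C -> C,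
      linear_fractional_semigroup phi /\ elliptic phi /\
      ~ trivial_semigroup phi /\ koenigs_function phi h)
   <->
   (exists (tau : C) (beta : sphere),
      disc tau /\ outside_disc beta /\
      forall z, disc z ->
        h z = (1 - sphere_inv beta * tau) *
              ((z - tau) / (1 - sphere_inv beta * z))))
  /\
  ((exists phi : R -> C -> C,
      linear_fractional_semigroup phi /\ hyperbolic phi /\
      koenigs_function phi h)
   <->
   (exists alpha : R, (alpha < 0)%R /\
      exists (tau : C) (beta : sphere),
        circle tau /\ outside_disc beta /\ beta <> Fin tau /\
        forall z, disc z ->
          h z = RtoC alpha *
                Clog ((1 - Cconj tau * z) / (1 - sphere_inv beta * z))))
  /\
  ((exists phi : R -> C -> C,
      linear_fractional_semigroup phi /\ parabolic phi /\
      koenigs_function phi h)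
   <->
   (exists alpha : C, alpha <> 0 /\ (Re alpha <= 0)%R /\
      exists tau : C,
        circle tau /\
        forall z, disc z -> h z = alpha * (z / (z - tau)))).
Proof.
  split; [| split]; split.
  - intros (phi & Hphi & Hell & _ & HK). now apply (elliptic_koenigs phi).
  - intros (tau & beta & Htau & Hbeta & Hh). now apply (elliptic_model h h_holo tau beta).
  - intros (phi & Hphi & Hhyp & HK). now apply (hyperbolic_koenigs phi).
  - intros (alpha & Ha & tau & beta & Htau & Hbeta & Hne & Hh).
    now apply (hyperbolic_model h h_holo alpha tau beta).
  - intros (phi & Hphi & Hpar & HK). now apply (parabolic_koenigs phi).
  - intros (alpha & Ha & Hre & tau & Htau & Hh). now apply (parabolic_model h h_holo alpha tau).
Qed.
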